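(* Let $T=C$ (the Cesàro operator) or $T=C^*$ (the Copson operator). Let $I=[0,1]$ or $I=[0,\infty)$ and suppose that $X$ is an order continuous Banach function space on $I$ with $TX\ne\{0\}$. Then (i) $TX$ is not isomorphic to a dual space; (ii) $TX$ does not have the Radon–Nikodym property.
   Context: $L^0(I)$ is the space of (a.e. equivalence classes of) real-valued Lebesgue measurable functions on $I$. A Banach function space $X$ on $I$ is a Banach space that is a linear subspace of $L^0(I)$ with the ideal property: $|f|\le|g|$ a.e., $f\in L^0(I)$, $g\in X$ imply $f\in X$ and $\|f\|_X\le\|g\|_X$; by convention $X$ is also assumed to contain a function positive a.e. on $I$ (this is not assumed for the derived space $TX$). $X$ is order continuous if for every $f\in X$ and every decreasing sequence of measurable sets $A_n\subset I$ with empty intersection, $\|f\chi_{A_n}\|_X\to0$. Cesàro operator: $Cf(x)=\frac1x\int_0^x f(t)\,dt$ for $0<x\in I$. Copson operator: $C^*f(x)=\int_{I\cap[x,\infty)}\frac{f(t)}{t}\,dt$ for $x\in I$. $TX=\{f\in L^0(I): T|f|\in X\}$ with norm $\|f\|_{TX}=\|T|f|\|_X$. *)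

(* Defs.v *)
From HB Require Import structures.
From mathcomp Require Import all_boot all_order all_algebra.
From mathcomp Require Import all_classical all_reals.
From mathcomp Require Import ereal topology normedtype sequences measure.
From mathcomp Require Import measurable_realfun lebesgue_measure numfun exp.
From mathcomp Require Import lebesgue_integral hoelder.

Set Implicit Arguments.
Unset Strict Implicit.
Unset Printing Implicit Defensive.

Import Order.TTheory GRing.Theory Num.Theory.
Import numFieldNormedType.Exports.

Local Open Scope classical_set_scope.
Local Open Scope ring_scope.

(* A linear subspace of V with a norm of its own.  ns_norm is a total function
   on V; its values off ns_carrier are meaningless.  The coercion ns_type turns
   it into a normedModType. *)
Record normedSubspace (K : numFieldType) (V : lmodType K) := NormedSubspace {
  ns_carrier : set V ;
  ns_norm : V -> K ;
  ns_zero : ns_carrier 0 ;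
  ns_add : forall u v, ns_carrier u -> ns_carrier v -> ns_carrier (u + v) ;
  ns_scale : forall a v, ns_carrier v -> ns_carrier (a *: v) ;
  ns_normD : forall u v, ns_carrier u -> ns_carrier v ->
    ns_norm (u + v) <= ns_norm u + ns_norm v ;
  ns_normZ : forall a v, ns_carrier v -> ns_norm (a *: v) = `|a| * ns_norm v ;
  ns_norm0 : forall v, ns_carrier v -> ns_norm v = 0 -> v = 0 }.

Section NormedSubspaceType.
Context (K : numFieldType) (V : lmodType K) (S : normedSubspace V).

Definition ns_pred : {pred V} := fun v => v \in ns_carrier S.

Lemma ns_pred_submod : submod_closed ns_pred.
Proof.
split=> [|a u v]; rewrite /ns_pred !unfold_in.
  exact/mem_set/ns_zero.
by move=> /set_mem Su /set_mem Sv; apply/mem_set/ns_add => //; exact: ns_scale.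
Qed.

HB.instance Definition _ :=
  GRing.isSubmodClosed.Build K V ns_pred ns_pred_submod.

Record ns_type := NsElt { ns_val :> V ; ns_valP : ns_val \in ns_pred }.

HB.instance Definition _ := [isSub for ns_val].
HB.instance Definition _ := [Choice of ns_type by <:].
HB.instance Definition _ := [SubChoice_isSubLmodule of ns_type by <:].

Lemma ns_val_carrier (u : ns_type) : ns_carrier S u.
Proof. exact/set_mem/(ns_valP u). Qed.

Definition ns_type_norm (u : ns_type) : K := ns_norm S u.

Lemma ns_type_normD u v :
  ns_type_norm (u + v) <= ns_type_norm u + ns_type_norm v.
Proof. by apply: ns_normD; exact: ns_val_carrier. Qed.

Lemma ns_type_normZ a u : ns_type_norm (a *: u) = `|a| * ns_type_norm u.
Proof. by apply: ns_normZ; exact: ns_val_carrier. Qed.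

Lemma ns_type_norm0 u : ns_type_norm u = 0 -> u = 0.
Proof. by move=> /ns_norm0 u0; apply/val_inj/u0/ns_val_carrier. Qed.

HB.instance Definition _ := Lmodule_isNormed.Build K ns_type
  ns_type_normD ns_type_normZ ns_type_norm0.

End NormedSubspaceType.

Coercion ns_type : normedSubspace >-> Sortclass.

Section L0.
Context d (T : measurableType d) (R : realType).
Context (mu : {measure set T -> \bar R}).

Local Open Scope quotient_scope.

(* MathComp-Analysis measures live on Borel sets, so representatives here are
   Borel functions.  Up to a.e. equality this is the same space as that of
   Lebesgue measurable functions, since each of the latter is a.e. equal to a
   Borel function.  The coercion L0_fun picks a representative. *)
Definition L0 : Type := {mfun_ mu, T >-> R}.
HB.instance Definition _ := Choice.on L0.
HB.instance Definition _ := EqQuotient.on L0.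
Definition L0_fun (f : L0) : T -> R := repr f.
Coercion L0_fun : L0 >-> Funclass.

Definition toL0 (f : {mfun T >-> R}) : L0 := \pi_L0 f.

Lemma toL0K (f : {mfun T >-> R}) : \forall x \ae mu, toL0 f x = f x.
Proof.
have : repr (toL0 f) == f %[mod L0] by rewrite reprK.
by rewrite eqmodE => /asboolP; apply: filterS => x; apply.
Qed.

Lemma L0_eqP (f g : L0) : (\forall x \ae mu, f x = g x) -> f = g.
Proof.
move=> fg; rewrite -[f]reprK -[g]reprK; apply/eqP; rewrite eqmodE.
by apply/asboolP; apply: filterS fg.
Qed.


Definition L0_zero : L0 := toL0 0.
Definition L0_opp (f : L0) : L0 := toL0 (- repr f).
Definition L0_add (f g : L0) : L0 := toL0 (repr f + repr g).
Definition L0_scale (a : R) (f : L0) : L0 := toL0 (a *: repr f).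

Let zeroE : \forall x \ae mu, L0_zero x = 0.
Proof. exact: toL0K. Qed.
Let oppE f : \forall x \ae mu, L0_opp f x = - f x.
Proof. exact: toL0K. Qed.
Let addE f g : \forall x \ae mu, L0_add f g x = f x + g x.
Proof. exact: toL0K. Qed.
Let scaleE a f : \forall x \ae mu, L0_scale a f x = a * f x.
Proof. exact: toL0K. Qed.

Let addA : associative L0_add.
Proof.
move=> f g h; apply: L0_eqP.
apply: filterS (filterI (addE f (L0_add g h)) (filterI (addE g h)
  (filterI (addE (L0_add f g) h) (addE f g)))).
by move=> x [-> [-> [-> ->]]]; rewrite addrA.
Qed.

Let addC : commutative L0_add.
Proof.
move=> f g; apply: L0_eqP; apply: filterS (filterI (addE f g) (addE g f)).
by move=> x [-> ->]; rewrite addrC.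
Qed.

Let add0 : left_id L0_zero L0_add.
Proof.
move=> f; apply: L0_eqP; apply: filterS (filterI (addE L0_zero f) zeroE).
by move=> x [-> ->]; rewrite add0r.
Qed.

Let addN : left_inverse L0_zero L0_opp L0_add.
Proof.
move=> f; apply: L0_eqP.
apply: filterS (filterI (addE (L0_opp f) f) (filterI zeroE (oppE f))).
by move=> x [-> [-> ->]]; rewrite addNr.
Qed.

HB.instance Definition _ := GRing.isZmodule.Build L0 addA addC add0 addN.

Let scaleA a b f : L0_scale a (L0_scale b f) = L0_scale (a * b) f.
Proof.
apply: L0_eqP.
apply: filterS (filterI (scaleE a (L0_scale b f))
  (filterI (scaleE b f) (scaleE (a * b) f))).
by move=> x [-> [-> ->]]; rewrite mulrA.
Qed.

Let scale1 : left_id 1 L0_scale.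
Proof.
by move=> f; apply: L0_eqP; apply: filterS (scaleE 1 f) => x ->; rewrite mul1r.
Qed.

Let scaleDr : right_distributive L0_scale +%R.
Proof.
move=> a f g; apply: L0_eqP.
apply: filterS (filterI (scaleE a (L0_add f g)) (filterI (addE f g)
  (filterI (scaleE a f) (filterI (scaleE a g)
    (addE (L0_scale a f) (L0_scale a g)))))).
by move=> x [-> [-> [e1 [e2 ->]]]]; rewrite e1 e2 mulrDr.
Qed.

Let scaleDl f : {morph L0_scale^~ f : a b / a + b}.
Proof.
move=> a b; apply: L0_eqP.
apply: filterS (filterI (scaleE (a + b) f) (filterI (scaleE a f)
  (filterI (scaleE b f) (addE (L0_scale a f) (L0_scale b f))))).
by move=> x [-> [e1 [e2 ->]]]; rewrite e1 e2 mulrDl.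
Qed.

HB.instance Definition _ := GRing.Zmodule_isLmodule.Build R L0
  scaleA scale1 scaleDr scaleDl.

Lemma L0_0E : \forall x \ae mu, (0 : L0) x = 0.
Proof. exact: zeroE. Qed.

Lemma L0_DE (f g : L0) : \forall x \ae mu, (f + g : L0) x = f x + g x.
Proof. exact: addE. Qed.

Lemma L0_ZE a (f : L0) : \forall x \ae mu, (a *: f : L0) x = a * f x.
Proof. exact: scaleE. Qed.

Definition L0_restrict (f : L0) (A : set T) (mA : measurable A) : L0 :=
  toL0 (repr f * (mindic R mA : {mfun T >-> R})).

Definition ae_represents (g : L0) (h : T -> \bar R) :=
  \forall x \ae mu, h x = (g x)%:E.

End L0.
Arguments L0 {d T R} mu.


Section Interval.
Context (R : realType).
Implicit Types (f g : R -> R).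

Inductive domain := UnitInterval | HalfLine.

Definition dom_set (I : domain) : set R :=
  match I with
  | UnitInterval => `[0, 1]
  | HalfLine => `[0, +oo[
  end.

Lemma measurable_dom I : measurable (dom_set I : set (measurableTypeR R)).
Proof. by case: I; exact: measurable_itv. Qed.

(* The classes of functions on the interval I are encoded as classes, for
   Lebesgue measure restricted to I, of functions on the line. *)
Definition mu_on (I : domain) : {measure set (measurableTypeR R) -> \bar R} :=
  mrestr lebesgue_measure (measurable_dom I).

Inductive averaging_op := Cesaro | Copson.

(* Extended-real valued, so that it makes sense for every measurable f >= 0.
   For x in I, only the values of f on I matter; at x = 0 the factor 0^-1 is 0
   by convention, which is irrelevant a.e. *)
Definition averaging (T : averaging_op) (I : domain) (f : R -> R) (x : R) :
    \bar R :=
  (match T with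
  | Cesaro => (x^-1)%:E * \int[lebesgue_measure]_(t in `[0%R, x]) (f t)%:E
  | Copson =>
      \int[lebesgue_measure]_(t in dom_set I `&` `[x, +oo[) (f t / t)%:E
  end)%E.

Definition averaging_abs T I (f : R -> R) : R -> \bar R :=
  averaging T I (fun t => `|f t|).

#[local] Instance ae_lebesgue_filter :
  Filter (nbhs (almost_everywhere (@lebesgue_measure R))).
Proof. exact: (ae_filter_ringOfSetsType (@lebesgue_measure R)). Qed.

Lemma ae_mu_on I (P : measurableTypeR R -> Prop) :
  (\forall x \ae mu_on I, P x) <->
  (\forall x \ae lebesgue_measure, dom_set I x -> P x).
Proof.
split=> -[A [mA A0 PA]].
  exists (A `&` dom_set I); split => //.
    by apply: measurableI => //; exact: measurable_dom.
  by move=> x /= /not_implyP[Ix nP]; split => //; exact: PA.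
exists (A `|` ~` dom_set I); split => //.
- by apply: measurableU => //; apply: measurableC; exact: measurable_dom.
- rewrite /= /mrestr setIUl setICl setU0; apply/eqP.
  rewrite eq_le measure_ge0 andbT -A0 le_measure ?inE//.
  by apply: measurableI => //; exact: measurable_dom.
- move=> x /= nP; have [Ix|] := pselect (dom_set I x).
    by left; apply: PA => /(_ Ix).
  by right.
Qed.

Lemma dom_ge0 I x : dom_set I x -> 0 <= x.
Proof. by case: I => /=; rewrite in_itv/= => /andP[]. Qed.

Let K T I (x : R) : set R :=
  match T with Cesaro => `[0, x] | Copson => dom_set I `&` `[x, +oo[ end.
Let w T (t : R) : R :=
  match T with Cesaro => 1 | Copson => t^-1 end.
Let c T (x : R) : R := match T with Cesaro => x^-1 | Copson => 1 end.

Let averagingE T I f x : averaging T I f x =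
  ((c T x)%:E * \int[lebesgue_measure]_(t in K T I x) (f t * w T t)%:E)%E.
Proof.
case: T => /=; rewrite /averaging; last by rewrite mul1e.
by under [in RHS]eq_integral do rewrite mulr1.
Qed.

Let mK T I x : measurable (K T I x).
Proof.
case: T => /=; first exact: measurable_itv.
by apply: measurableI; [exact: measurable_dom|exact: measurable_itv].
Qed.

Let KI T I x : dom_set I x -> K T I x `<=` dom_set I.
Proof.
case: T => /=; last by move=> _ t [].
case: I => /=; rewrite !in_itv/=; last first.
  by move=> _ t /=; rewrite !in_itv/= => /andP[->].
by move=> /andP[_ x1] t /=; rewrite !in_itv/= => /andP[-> /le_trans->].
Qed.

Let K0 T I x t : K T I x t -> 0 <= t.
Proof.
by case: T => /=; [rewrite in_itv/= => /andP[]|move=> -[/dom_ge0]].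
Qed.

Let w0 T I x t : K T I x t -> 0 <= w T t.
Proof. by case: T => //= ; move=> /(@K0 Copson); rewrite invr_ge0. Qed.

Let mV (D : set R) : measurable D -> (forall x, D x -> 0 <= x) ->
  measurable_fun D (fun x : R => x^-1).
Proof.
move=> mD D0; apply: (eq_measurable_fun (fun x : R => x `^ (-1))).
  by move=> x /set_mem /D0 x0; rewrite powR_inv1.
by apply: measurable_funTS; exact: measurable_powR.
Qed.

Let mw T I x : measurable_fun (K T I x) (w T).
Proof.
have m0 := @K0 T I x; move: (mK T I x) m0; case: T => /= mK0 m0.
  exact: measurable_cst.
exact: mV.
Qed.

Let mfw T I x (f : R -> R) : measurable_fun setT f ->
  measurable_fun (K T I x) (fun t => (`|f t| * w T t)%:E).
Proof.
move=> mf; apply/measurable_EFinP; apply: measurable_funM; last exact: mw.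
by apply: measurable_funTS; exact: measurableT_comp.
Qed.

Let fw0 T I x (f : R -> R) t : K T I x t -> (0 <= (`|f t| * w T t)%:E)%E.
Proof. by move=> Kt; rewrite lee_fin mulr_ge0// (w0 Kt). Qed.

Let c0 T I x : dom_set I x -> 0 <= c T x.
Proof. by move=> /dom_ge0; case: T => //=; rewrite invr_ge0. Qed.

Lemma averaging_abs_ge0 T I f x : dom_set I x -> (0 <= averaging_abs T I f x)%E.
Proof.
move=> Ix; rewrite /averaging_abs averagingE mule_ge0 ?lee_fin ?(c0 _ Ix)//.
by apply: integral_ge0 => t; exact: fw0.
Qed.

Lemma le_averaging_abs T I f g x : measurable_fun setT f ->
  measurable_fun setT g -> dom_set I x ->
  (\forall t \ae mu_on I, `|f t| <= `|g t|) ->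
  (averaging_abs T I f x <= averaging_abs T I g x)%E.
Proof.
move=> mf mg Ix /ae_mu_on fg; rewrite /averaging_abs !averagingE.
apply: lee_wpmul2l; first by rewrite lee_fin (c0 _ Ix).
apply: ae_ge0_le_integral; first exact: mK.
- by move=> t; exact: fw0.
- exact: mfw.
- by move=> t; exact: fw0.
- exact: mfw.
- apply: filterS fg => t fg Kt; rewrite lee_fin ler_wpM2r ?(w0 Kt)//.
  by apply: fg; exact: (KI Ix Kt).
Qed.

Lemma averaging_absD T I f g x : measurable_fun setT f ->
  measurable_fun setT g -> dom_set I x ->
  (averaging_abs T I (f \+ g)%R x <=
   averaging_abs T I f x + averaging_abs T I g x)%E.
Proof.
move=> mf mg Ix; rewrite /averaging_abs !averagingE.
rewrite -ge0_muleDr; try by apply: integral_ge0 => t; exact: fw0.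
apply: lee_wpmul2l; first by rewrite lee_fin (c0 _ Ix).
rewrite -ge0_integralD; first last.
- exact: mfw.
- by move=> t; exact: fw0.
- exact: mfw.
- by move=> t; exact: fw0.
- exact: mK.
apply: ge0_le_integral; first exact: mK.
- by move=> t; exact: fw0.
- by apply: mfw; exact: measurable_funD.
- by apply: emeasurable_funD; exact: mfw.
- move=> t Kt; rewrite -EFinD lee_fin -mulrDl ler_wpM2r ?(w0 Kt)//.
  exact: ler_normD.
Qed.

Lemma averaging_absZ T I a f x : measurable_fun setT f -> dom_set I x ->
  averaging_abs T I (fun t => a * f t) x = (`|a|%:E * averaging_abs T I f x)%E.
Proof.
move=> mf Ix; rewrite /averaging_abs !averagingE muleCA; congr (_ * _)%E.
rewrite -ge0_integralZl_EFin; first last.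
- exact: normr_ge0.
- exact: mfw.
- by move=> t; exact: fw0.
- exact: mK.
- by apply: eq_integral => t _; rewrite normrM -mulrA.
Qed.

Let nondecreasing_emeasurable (F : R -> \bar R) :
  (forall x y, x <= y -> (F x <= F y)%E) -> measurable_fun setT F.
Proof.
move=> F_nd _; apply: (measurability _ (ErealGenCInfty.measurableE R)) => //.
move=> _ [_ [r ->] <-]; rewrite setTI.
apply: is_interval_measurable => s t/=; rewrite !in_itv/= !andbT => fs ft u.
by move=> /andP[su ut]; rewrite in_itv/= andbT (le_trans fs)// F_nd.
Qed.

Lemma measurable_averaging_abs T I f : measurable_fun setT f ->
  measurable_fun (dom_set I) (averaging_abs T I f).
Proof.
move=> mf.
rewrite (_ : averaging_abs T I f = (fun x => (c T x)%:E *
    \int[lebesgue_measure]_(t in K T I x) (`|f t| * w T t)%:E)%E); last first.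
  by apply/funext => x; rewrite /averaging_abs averagingE.
apply: emeasurable_funM.
  apply/measurable_EFinP; case: T => /=; last exact: measurable_cst.
  by apply: mV; [exact: measurable_dom|exact: dom_ge0].
apply: measurable_funTS.
have sub x y : K T I x `<=` K T I y ->
    (\int[lebesgue_measure]_(t in K T I x) (`|f t| * w T t)%:E <=
     \int[lebesgue_measure]_(t in K T I y) (`|f t| * w T t)%:E)%E.
  move=> xy; apply: ge0_subset_integral => //.
  - exact: mK.
  - exact: mK.
  - exact: mfw.
  - by move=> t; exact: fw0.
case: T sub => /= sub.
  apply: nondecreasing_emeasurable => x y xy; apply: sub => t /=.
  by rewrite !in_itv/= => /andP[-> /le_trans->].
apply: (eq_measurable_fun (fun x =>
    - - (\int[lebesgue_measure]_(t in K Copson I x) (`|f t| * w Copson t)%:E))%E).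
  by move=> x _; rewrite oppeK.
apply: (measurableT_comp (@oppe_measurable _ _)).
apply: nondecreasing_emeasurable => x y xy; rewrite leeN2; apply: sub => t /=.
by rewrite !in_itv/= !andbT => -[It yt]; split => //; exact: le_trans yt.
Qed.

Let ae_pick I (P : measurableTypeR R -> Prop) a b :
  (\forall x \ae mu_on I, P x) ->
  a < b -> `]a, b[ `<=` dom_set I -> exists2 x, a < x < b & P x.
Proof.
move=> /ae_mu_on [A [mA A0 PA]] ab abI; apply: contrapT => nP.
have abA : `]a, b[ `<=` A.
  move=> x abx; apply: PA => /= /(_ (abI _ abx)) Px; apply: nP.
  by exists x => //; move: abx; rewrite /= in_itv.
have : (lebesgue_measure `]a, b[ <= lebesgue_measure A)%E.
  by apply: le_measure => //; rewrite inE.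
by rewrite A0 lebesgue_measure_itv/= lte_fin ab -EFinB lee_fin subr_le0 leNgt ab.
Qed.

Let averaging_abs0_on T I f x : measurable_fun setT f -> dom_set I x -> 0 < x ->
  averaging_abs T I f x = 0%E ->
  \forall t \ae lebesgue_measure, K T I x t -> f t = 0.
Proof.
move=> mf Ix x0; rewrite /averaging_abs averagingE => /eqP.
rewrite mule_eq0 eqe => /orP[|/eqP].
  by case: T => /=; [rewrite invr_eq0 gt_eqF|rewrite oner_eq0].
move=> I0; have : (\int[lebesgue_measure]_(t in K T I x)
    `|(`|f t| * w T t)%:E| = 0)%E.
  rewrite -I0; apply: eq_integral => t /set_mem Kt.
  by rewrite gee0_abs// (fw0 _ Kt).
move=> /(ae_eq_integral_abs lebesgue_measure (@mK T I x) (@mfw T I x f mf)).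
have n0 : \forall t \ae lebesgue_measure, t != 0 :> R.
  exists [set 0]; split => //; first exact: lebesgue_measure_set1.
  by move=> t /= /negP; rewrite negbK => /eqP.
apply: filterS2 n0 => t t0 h Kt; have := h Kt => /= -[] /eqP.
rewrite mulf_eq0 normr_eq0 => /orP[/eqP//|].
by case: (T) => /=; [rewrite oner_eq0|rewrite invr_eq0 (negbTE t0)].
Qed.

Lemma averaging_abs_eq0 T I f : measurable_fun setT f ->
  (\forall x \ae mu_on I, averaging_abs T I f x = 0%E) ->
  \forall x \ae mu_on I, f x = 0.
Proof.
move=> mf f0.
have [ab [abI0 abK]] : exists ab : nat -> R * R,
    (forall n, (ab n).1 < (ab n).2 /\
       `](ab n).1, (ab n).2[ `<=` dom_set I `&` [set x | 0 < x]) /\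
    (forall x : nat -> R, (forall n, (ab n).1 < x n < (ab n).2) ->
       forall t, dom_set I t -> t != 0 -> t != 1 -> exists n, K T I (x n) t).
  have gt0E (t : R) : dom_set I t -> t != 0 -> 0 < t.
    by move=> /dom_ge0; rewrite le_eqVlt eq_sym => /orP[/eqP->|//]; rewrite eqxx.
  case: T f0 => _ /=; last first.
    exists (fun n => (0, n.+1%:R^-1)); split => [n|x xP t It t0 _] /=.
      split; first by rewrite invr_gt0.
      move=> y /=; rewrite in_itv/= => /andP[y0 yn]; split => //.
      have y1 : y <= 1 by rewrite (le_trans (ltW yn))// invf_le1// ler1n.
      by case: (I); rewrite /= in_itv/= (ltW y0).
    have [n] := ltr_add_invr (gt0E _ It t0); rewrite add0r => nt.
    exists n; split => //; rewrite /= in_itv/= andbT.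
    by have /andP[_ /ltW xn] := xP n; rewrite (le_trans xn)// ltW.
  case: I gt0E => gt0E.
    exists (fun n => (1 - n.+1%:R^-1, 1)); split => [n|x xP t It t0 t1] /=.
      have n1 : n.+1%:R^-1 <= 1 :> R by rewrite invf_le1// ler1n.
      split; first by rewrite ltrBlDr ltrDl invr_gt0.
      move=> y /=; rewrite !in_itv/= => /andP[ny y1].
      have y0 : 0 < y by rewrite (le_lt_trans _ ny)// subr_ge0.
      by split => //; rewrite (ltW y0) ltW.
    move: It; rewrite /= in_itv/= => /andP[t0' t1'].
    have /ltr_add_invr[n nt] : t < 1 by rewrite lt_neqAle t1.
    exists n; rewrite /= in_itv/= t0'/=.
    have /andP[/ltW xn _] := xP n; rewrite (le_trans _ xn)//.
    by rewrite lerBrDr ltW.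
  exists (fun n => (n%:R, n.+1%:R)); split => [n|x xP t It t0 t1] /=.
    split; first by rewrite ltr_nat.
    move=> y /=; rewrite !in_itv/= => /andP[ny _].
    by have y0 : 0 < y; [rewrite (le_lt_trans _ ny)|split; rewrite ?ltW].
  move: It; rewrite /= in_itv/= andbT => t0'.
  exists (Num.bound t); rewrite /= in_itv/= t0'/=.
  have /andP[/ltW xn _] := xP (Num.bound t).
  by rewrite (le_trans _ xn)// ltW// archi_boundP.
have /choice[x xP] n : exists x, [/\ (ab n).1 < x < (ab n).2, dom_set I x, 0 < x
    & averaging_abs T I f x = 0%E].
  have [ab0 abI] := abI0 n.
  have abI' : `](ab n).1, (ab n).2[ `<=` dom_set I by move=> y /abI[].
  have [x xab fx] := ae_pick f0 ab0 abI'.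
  have /abI[Ix x0] : `](ab n).1, (ab n).2[%classic x by rewrite /= in_itv.
  by exists x.
apply/ae_mu_on.
have h n : \forall t \ae lebesgue_measure, K T I (x n) t -> f t = 0.
  by have [_ Ix x0 fx] := xP n; exact: averaging_abs0_on.
have n01 (a : R) : \forall t \ae lebesgue_measure, t != a.
  exists [set a]; split => //; first exact: lebesgue_measure_set1.
  by move=> t /= /negP; rewrite negbK => /eqP.
have hh : \forall t \ae lebesgue_measure, forall n, K T I (x n) t -> f t = 0.
  exact/ae_foralln.
apply: filterS3 (n01 0) (n01 1) hh => t t0 t1 ht It.
have [n Kn] : exists n, K T I (x n) t by apply: abK => // n; case: (xP n).
exact: ht Kn.
Qed.

End Interval.

Section BanachFunctionSpace.
Context (R : realType) (I : domain).
Local Notation mu := (mu_on R I).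
Implicit Types f g : L0 mu.

#[local] Instance ae_mu_on_filter : Filter (nbhs (almost_everywhere mu)).
Proof. exact: (ae_filter_ringOfSetsType mu). Qed.

Record banachFunctionSpace := BanachFunctionSpace {
  bfs_space :> normedSubspace (L0 mu) ;
  bfs_complete : forall F : set_system bfs_space,
    ProperFilter F -> cauchy F -> cvg F ;
  bfs_ideal : forall f g : L0 mu, (\forall x \ae mu, `|f x| <= `|g x|) ->
    ns_carrier bfs_space g ->
    ns_carrier bfs_space f /\ ns_norm bfs_space f <= ns_norm bfs_space g ;
  bfs_positive : exists2 u : L0 mu,
    ns_carrier bfs_space u & \forall x \ae mu, 0 < u x }.

Definition order_continuous (X : banachFunctionSpace) :=
  forall (f : L0 mu) (A : nat -> set (measurableTypeR R))
      (mA : forall n, measurable (A n)),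
    ns_carrier X f -> (forall n, A n `<=` dom_set I) ->
    (forall n, A n.+1 `<=` A n) -> \bigcap_n A n = set0 ->
    ns_norm X (L0_restrict f (mA n)) @[n --> \oo] --> (0 : R).

Lemma ae_represents_uniq (g g' : L0 mu) h :
  ae_represents g h -> ae_represents g' h -> g = g'.
Proof.
move=> gh g'h; apply: L0_eqP; apply: filterS2 gh g'h => x -> [].
by [].
Qed.

Lemma ae_represents_ex (h : measurableTypeR R -> \bar R) :
  measurable_fun (dom_set I) h -> (\forall x \ae mu, h x \is a fin_num) ->
  exists g : L0 mu, ae_represents g h.
Proof.
move=> mh hfin.
have mh' : measurable_fun [set: measurableTypeR R] (fine \o (h \_ (dom_set I))).
  apply: measurableT_comp; first exact: fine_measurable.
  by apply/(measurable_restrictT _ _).1 => //; exact: measurable_dom.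
pose h' : {mfun (measurableTypeR R) >-> R} :=
  @mfun_Sub _ _ (measurableTypeR R) R _ (mem_set mh').
exists (toL0 mu h'); have := toL0K mu h'.
have aeI : \forall x \ae mu, dom_set I x by apply/ae_mu_on; exact: aeW.
move=> e; rewrite /ae_represents; apply: filterS3 hfin aeI e => x hx Ix ->.
by rewrite /= patchE mem_set// fineK.
Qed.

Section Space.
Context (T : averaging_op) (X : banachFunctionSpace).

(* T|f| belongs to X when it is a.e. equal to a real valued function whose
   class is in X; in particular T|f| must be finite a.e. on I. *)
Definition TX_carrier : set (L0 mu) :=
  [set f | exists2 g, ns_carrier X g & ae_represents g (averaging_abs T I f)].

Definition TX_norm (f : L0 mu) : R :=
  ns_norm X (xget (0 : L0 mu)
    [set g : L0 mu | ae_represents g (averaging_abs T I f)]).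

Let aeI : \forall x \ae mu, dom_set I x.
Proof. by apply/ae_mu_on; apply: aeW. Qed.

Let mf (f : L0 mu) : measurable_fun [set: R] (f : R -> R).
Proof. exact: (measurable_funP (repr f)). Qed.

Let TX_normE f g : ae_represents g (averaging_abs T I f) ->
  TX_norm f = ns_norm X g.
Proof.
move=> gf; congr ns_norm; case: xgetP => [g' _ /= g'f|/(_ g)//].
exact: ae_represents_uniq g'f gf.
Qed.

Let avgD (f1 f2 : L0 mu) : \forall x \ae mu,
  (averaging_abs T I ((f1 + f2)%R : L0 mu) x <=
  averaging_abs T I f1 x + averaging_abs T I f2 x)%E.
Proof.
apply: filterS aeI => x Ix.
apply: le_trans (averaging_absD T (mf f1) (mf f2) Ix).
apply: le_averaging_abs => //; first exact: measurable_funD (mf f1) (mf f2).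
by apply: filterS (L0_DE f1 f2) => t ->.
Qed.

Let avgZ a f : \forall x \ae mu, averaging_abs T I (a *: f : L0 mu) x =
  (`|a|%:E * averaging_abs T I f x)%E.
Proof.
apply: filterS aeI => x Ix; rewrite -averaging_absZ//.
have maf : measurable_fun setT (fun t => a * f t) by exact: measurable_funM.
apply/eqP; rewrite eq_le; apply/andP; split; apply: le_averaging_abs => //;
  by apply: filterS (L0_ZE a f) => t ->.
Qed.

Let TX_Z a f g : ae_represents g (averaging_abs T I f) ->
  ae_represents (`|a| *: g) (averaging_abs T I (a *: f : L0 mu)).
Proof.
move=> gf; rewrite /ae_represents.
apply: filterS3 gf (avgZ a f) (L0_ZE `|a| g) => x gf -> ->.
by rewrite gf EFinM.
Qed.

Let TX_D (f1 f2 g1 g2 : L0 mu) : ns_carrier X g1 -> ns_carrier X g2 ->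
  ae_represents g1 (averaging_abs T I f1) ->
  ae_represents g2 (averaging_abs T I f2) ->
  exists g, [/\ ns_carrier X g, ns_norm X g <= ns_norm X g1 + ns_norm X g2 &
    ae_represents g (averaging_abs T I (f1 + f2 : L0 mu))].
Proof.
move=> Xg1 Xg2 gf1 gf2.
have le12 : \forall x \ae mu, dom_set I x /\
    (averaging_abs T I ((f1 + f2)%R : L0 mu) x <= (((g1 + g2)%R : L0 mu) x)%:E)%E.
  apply: filterS2 (filterI aeI (avgD f1 f2))
    (filterI (L0_DE g1 g2) (filterI gf1 gf2)) => x.
  by move=> [Ix le12] [-> [e1 e2]]; rewrite EFinD -e1 -e2.
have [g gf] : exists g : L0 mu,
    ae_represents g (averaging_abs T I (f1 + f2 : L0 mu)).
  apply: ae_represents_ex; first exact: measurable_averaging_abs.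
  apply: filterS le12 => x [Ix lex].
  by rewrite ge0_fin_numE ?averaging_abs_ge0// (le_lt_trans lex) ?ltry.
have [|Xg leg] := @bfs_ideal X g (g1 + g2) _ (ns_add Xg1 Xg2).
  apply: filterS2 le12 gf => x [Ix] + gx.
  have := averaging_abs_ge0 T (f1 + f2 : L0 mu) Ix.
  rewrite gx !lee_fin => g0 le; rewrite !ger0_norm//.
  exact: le_trans le.
exists g; split => //; apply: (le_trans leg); exact: ns_normD.
Qed.

Lemma TX_zero : TX_carrier 0.
Proof.
exists 0; first exact: ns_zero.
have := avgZ 0 0; rewrite scale0r => avg0; rewrite /ae_represents.
apply: filterS2 avg0 (L0_0E mu) => x -> ->.
by rewrite normr0 mul0e.
Qed.

Lemma TX_add (f1 f2 : L0 mu) :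
  TX_carrier f1 -> TX_carrier f2 -> TX_carrier (f1 + f2).
Proof.
move=> [g1 Xg1 gf1] [g2 Xg2 gf2].
by have [g [Xg _ gf]] := TX_D Xg1 Xg2 gf1 gf2; exists g.
Qed.

Lemma TX_scale a f : TX_carrier f -> TX_carrier (a *: f).
Proof.
by move=> [g Xg gf]; exists (`|a| *: g); [exact: ns_scale|exact: TX_Z].
Qed.

Lemma TX_normD (f1 f2 : L0 mu) : TX_carrier f1 -> TX_carrier f2 ->
  TX_norm (f1 + f2) <= TX_norm f1 + TX_norm f2.
Proof.
move=> [g1 Xg1 gf1] [g2 Xg2 gf2].
have [g [Xg leg gf]] := TX_D Xg1 Xg2 gf1 gf2.
by rewrite (TX_normE gf) (TX_normE gf1) (TX_normE gf2).
Qed.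

Lemma TX_normZ a f : TX_carrier f -> TX_norm (a *: f) = `|a| * TX_norm f.
Proof.
move=> [g Xg gf]; rewrite (TX_normE (TX_Z a gf)) (TX_normE gf).
by rewrite ns_normZ// normr_id.
Qed.

Lemma TX_norm0 f : TX_carrier f -> TX_norm f = 0 -> f = 0.
Proof.
move=> [g Xg gf]; rewrite (TX_normE gf) => /(ns_norm0 Xg) g0.
apply: L0_eqP.
have : \forall x \ae mu, f x = 0.
  apply: (averaging_abs_eq0 (T := T)) => //.
  by apply: filterS2 gf (L0_0E mu) => x ->; rewrite g0 => ->.
by move=> f0; apply: filterS2 f0 (L0_0E mu) => x -> ->.
Qed.

Definition TX : normedSubspace (L0 mu) := NormedSubspace
  TX_zero TX_add TX_scale TX_normD TX_normZ TX_norm0.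

End Space.
End BanachFunctionSpace.

Section Dual.
Context (R : realType) (E : normedModType R).

Definition dual_carrier : set (E -> R^o) := [set u | linear u /\ continuous u].

Definition dual_norm (u : E -> R^o) : R :=
  sup [set `|u x| | x in [set x : E | `|x| <= 1]].

Let pack_linear (u : E -> R^o) (lu : linear u) : {linear E -> R^o}
  := HB.pack u (GRing.isLinear.Build _ _ _ _ _ lu).

Let dual_bounded u : dual_carrier u ->
  has_sup [set `|u x| | x in [set x : E | `|x| <= 1]].
Proof.
move=> [lu cu]; split.
  by exists `|u 0|, 0 => //=; rewrite normr0.
have /linear_boundedP/pinfty_ex_gt0[r r0 ur] :=
  continuous_linear_bounded (f := pack_linear lu) 0 (cu 0).
exists r => _ [x /= x1 <-]; apply: (le_trans (ur x)).
by rewrite ler_piMr// ltW.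
Qed.

Let dual_le u x : dual_carrier u -> `|u x| <= dual_norm u * `|x|.
Proof.
move=> Du; have [lu cu] := Du.
have [->|x0] := eqVneq x 0.
  by rewrite [u 0](linear0 (pack_linear lu)) !normr0 mulr0.
have nx : 0 < `|x| by rewrite normr_gt0.
rewrite -ler_pdivrMr//.
have -> : `|u x| / `|x| = `|u (`|x|^-1 *: x)|.
  have -> : u (`|x|^-1 *: x) = `|x|^-1 *: u x.
    exact: (linearZZ (pack_linear lu)).
  by rewrite normrZ gtr0_norm ?invr_gt0// mulrC.
apply: (ub_le_sup (dual_bounded Du).2).
exists (`|x|^-1 *: x) => //=.
by rewrite normrZ gtr0_norm ?invr_gt0// mulVf ?gt_eqF.
Qed.

Lemma dual_zero : dual_carrier 0.
Proof.
split=> [a x y|x]; first by rewrite /= scaler0 addr0.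
exact: cst_continuous.
Qed.

Lemma dual_add u v : dual_carrier u -> dual_carrier v -> dual_carrier (u + v).
Proof.
move=> [lu cu] [lv cv]; split=> [a x y|x].
  by rewrite /= !fctE lu lv scalerDr addrACA.
exact: cvgD (cu x) (cv x).
Qed.

Lemma dual_scale a u : dual_carrier u -> dual_carrier (a *: u).
Proof.
move=> [lu cu]; split=> [b x y|x].
  by rewrite /= !fctE lu scalerDr !scalerA mulrC.
exact: cvgZl_tmp (cu x).
Qed.

Let dual_norm_le u (r : R) : (forall x, `|x| <= 1 -> `|u x| <= r) ->
  dual_norm u <= r.
Proof.
move=> ur; apply: ge_sup.
  by exists `|u 0|, 0 => //=; rewrite normr0.
by move=> _ [x /= x1 <-]; exact: ur.
Qed.

Let dual_norm_ge u x : dual_carrier u -> `|x| <= 1 -> `|u x| <= dual_norm u.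
Proof.
by move=> Du x1; apply: (ub_le_sup (dual_bounded Du).2); exists x.
Qed.

Lemma dual_normD u v : dual_carrier u -> dual_carrier v ->
  dual_norm (u + v) <= dual_norm u + dual_norm v.
Proof.
move=> Du Dv; apply: dual_norm_le => x x1.
by rewrite fctE (le_trans (ler_normD _ _))// lerD ?dual_norm_ge.
Qed.

Let dual_normZ_le a u : dual_carrier u ->
  dual_norm (a *: u) <= `|a| * dual_norm u.
Proof.
move=> Du; apply: dual_norm_le => x x1.
by rewrite fctE normrZ ler_wpM2l// dual_norm_ge.
Qed.

Lemma dual_normZ a u : dual_carrier u ->
  dual_norm (a *: u) = `|a| * dual_norm u.
Proof.
move=> Du; have [->|a0] := eqVneq a 0.
  rewrite scale0r normr0 mul0r; apply/eqP; rewrite eq_le.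
  rewrite dual_norm_le => [|x _]; last by rewrite normr0.
  by rewrite (le_trans _ (@dual_norm_ge 0 0 dual_zero _))// normr0.
apply/eqP; rewrite eq_le dual_normZ_le//= -ler_pdivlMl ?normr_gt0//.
rewrite -normfV -[X in dual_norm X <= _](@scalerK _ _ a)//.
by apply: dual_normZ_le; exact: dual_scale.
Qed.

Lemma dual_norm0 u : dual_carrier u -> dual_norm u = 0 -> u = 0.
Proof.
move=> Du u0; apply/funext => x; apply/eqP; rewrite -normr_le0.
by rewrite (le_trans (dual_le x Du))// u0 mul0r.
Qed.

Definition dual : normedSubspace (E -> R^o) := NormedSubspace
  dual_zero dual_add dual_scale dual_normD dual_normZ dual_norm0.

End Dual.

Definition isomorphic (R : realType) (U V : normedModType R) :=
  exists (f : {linear U -> V}) (g : V -> U),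
    [/\ cancel f g, cancel g f, continuous f & continuous g].

Definition isomorphic_to_dual (R : realType) (Y : normedModType R) :=
  exists E : completeNormedModType R, isomorphic Y (dual E).

Section Bochner.
Context (R : realType) (Y : normedModType R).
Context d (Omega : measurableType d).
Context (mu : {measure set Omega -> \bar R}).

Definition simple_function (s : Omega -> Y) :=
  finite_set (range s) /\ forall y, measurable (s @^-1` [set y]).

(* This formula gives the integral only when mu is finite on the level sets;
   it is used below for finite measures only. *)
Definition simple_integral (A : set Omega) (s : Omega -> Y) : Y :=
  \sum_(y \in range s) fine (mu (A `&` s @^-1` [set y])) *: y.

(* Witnesses Bochner integrability of g over the whole space.  When mu is not
   complete, |g - s n| is measurable only for the completion of mu; for
   nonnegative functions the integral of the library is the lower integral,
   which agrees there with the integral for the completion. *)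
Definition bochner_approx (g : Omega -> Y) (s : nat -> Omega -> Y) :=
  [/\ forall n, simple_function (s n),
      \forall w \ae mu, s n w @[n --> \oo] --> g w &
      (\int[mu]_w (`|g w - s n w|)%:E)%E @[n --> \oo] --> 0%E].

Definition is_bochner_integral (A : set Omega) (g : Omega -> Y) (y : Y) :=
  exists2 s, bochner_approx g s &
    simple_integral A (s n) @[n --> \oo] --> y.

(* Set functions are total; only their values on measurable sets matter. *)
Definition vector_measure (G : set Omega -> Y) :=
  forall F : nat -> set Omega, (forall n, measurable (F n)) ->
    trivIset setT F -> series (G \o F) @ \oo --> G (\bigcup_n F n).

Definition bounded_variation (G : set Omega -> Y) :=
  exists M : R, forall (n : nat) (F : 'I_n -> set Omega),
    (forall i, measurable (F i)) -> trivIset setT F ->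
    \bigcup_i F i = setT -> \sum_(i < n) `|G (F i)| <= M.

Definition mu_continuous (G : set Omega -> Y) :=
  forall e : R, 0 < e -> exists2 r : R, 0 < r &
    forall A, measurable A -> (mu A < r%:E)%E -> `|G A| < e.

End Bochner.

Definition radon_nikodym_property (R : realType) (Y : normedModType R) :=
  forall (d : measure_display) (Omega : measurableType d)
      (mu : {finite_measure set Omega -> \bar R}) (G : set Omega -> Y),
    vector_measure G -> bounded_variation G -> mu_continuous mu G ->
    exists g : Omega -> Y, (exists s, bochner_approx mu g s) /\
      forall A, measurable A -> is_bochner_integral mu A g (G A).

(* Main.v *)
From HB Require Import structures.
Require Import Defs.
From mathcomp Require Import all_boot all_order all_algebra.
From mathcomp Require Import all_classical all_reals.
From mathcomp Require Import ereal topology normedtype sequences measure.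
From mathcomp Require Import measurable_realfun lebesgue_measure numfun exp.
From mathcomp Require Import lebesgue_integral hoelder charge.
From mathcomp Require Import ring lra.

Set Implicit Arguments.
Unset Strict Implicit.
Unset Printing Implicit Defensive.

Import Order.TTheory GRing.Theory Num.Theory.
Import numFieldNormedType.Exports.

Local Open Scope classical_set_scope.
Local Open Scope ring_scope.

(** The space TX contains a copy of L^1 of an interval J, embedded as the closed
    span of the indicator functions of subsets of J.  The argument is the
    classical one for why L^1 neither has the Radon-Nikodym property nor embeds
    in a separable dual, in a form that needs only indicator functions.

    The copy of L^1.  If f <> 0 is in TX and T|f|(c) > 0, then T|f| dominates a
    multiple of the profile of c, the shape x |-> 1/x on x >= c (Cesaro) or 1 on
    x <= c (Copson) of T applied to a unit mass at c; so that profile is in X.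
    For J = [a, b] in the interior of I the kernel of T is bounded above and
    below on J, and T of the indicator of B included in J lies between multiples
    of |B| times the profiles of the two ends of J.  Hence
    k|B| <= ||1_B|| <= K|B| (good_indic_ge, good_indic_le), and
    G(B) = 1_(B n J) is a countably additive vector measure with values in TX,
    Lipschitz for Lebesgue measure on J.

    No approximate density.  Call (A, y) an almost density of G at scale eps if
    |A| > 0 and || G(B) - |B| y || <= eps |B| for all B included in A.  For
    small eps there is none: the means G(B)/|B| and G(A)/|A| would be
    2 eps-close for every B in A, while for |B| <= |A|/2 they differ by at
    least 1/(2|B|) on B, so by at least k/2 in norm (indic_measure_no_almost_density).

    The Radon-Nikodym property produces almost densities: a Bochner density g
    is, on a set A of positive measure, eps-close to one value y of a simple
    function (rnp_almost_density).

    An isomorphism of TX with a dual E* produces them as well, as soon as TX has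
    a dense sequence (y_n).  Otherwise, by the Hahn decomposition, there are
    nested sets A_n of positive measure and e_n in the unit ball of E such that
    every mean of G over a subset of A_(n+1) exceeds y_n by a fixed amount when
    evaluated at e_n.  A weak-star cluster point of the means G(A_n)/|A_n| is
    then at a fixed distance from all y_n, against density
    (separable_dual_almost_density).

    Separability of TX is where order continuity of X enters most.  It gives
    dominated convergence in X, hence in TX (TX_order_continuous); so it is
    enough to approximate indicators of subsets of intervals [a, b] with
    rational ends for which the bounds above hold, since such intervals cover the support of every
    f in TX (ae_support_good); and indicators are reached from rational rays by
    the pi-lambda theorem (rat_closure_indic). *)

(** * Lipschitz vector measures and almost densities *)

Section LipschitzVectorMeasure.
Context (R : realType) (Y : normedModType R).
Context d (Omega : measurableType d).
Context (mu : {finite_measure set Omega -> \bar R}).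
Implicit Types (G : set Omega -> Y) (A B S : set Omega) (eps : R).

(** This replaces a density of G at a point of A: it says that all means of G
    over subsets of A are within eps of y. *)
Definition almost_density G eps A (y : Y) :=
  [/\ measurable A, (0 < mu A)%E & forall B, measurable B -> B `<=` A ->
    `|G B - fine (mu B) *: y| <= eps * fine (mu B)].

Definition lipschitz_set_function G (K : R) :=
  forall A, measurable A -> `|G A| <= K * fine (mu A).

Lemma mu_fineK A : measurable A -> (fine (mu A))%:E = mu A.
Proof. by move=> mA; rewrite fineK// fin_num_measure. Qed.

Lemma mu_fine_gt0 A : measurable A -> (0 < fine (mu A)) = (0 < mu A)%E.
Proof. by move=> mA; rewrite -lte_fin mu_fineK. Qed.

Lemma sum_fine_measure_cvg (F : nat -> set Omega) :
  (forall n, measurable (F n)) -> trivIset setT F ->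
  (fun n => \sum_(0 <= i < n) fine (mu (F i))) @ \oo -->
    fine (mu (\bigcup_n F n)).
Proof.
move=> mF tF; have mUF : measurable (\bigcup_n F n) by exact: bigcupT_measurable.
have h : (fun n => (\sum_(0 <= i < n) mu (F i))%E) @ \oo -->
    (fine (mu (\bigcup_n F n)))%:E.
  by rewrite mu_fineK//; exact: measure_semi_sigma_additive.
move/fine_cvg: h; suff -> : fine \o (fun n => (\sum_(0 <= i < n) mu (F i))%E) =
  (fun n => \sum_(0 <= i < n) fine (mu (F i))) by [].
apply/funext => n; rewrite -[RHS]/(fine (EFin _)); congr fine.
by rewrite -sumEFin; apply: eq_bigr => i _; rewrite mu_fineK.
Qed.

Section Functional.
Variables (G : set Omega -> Y) (G_vm : vector_measure G) (K : R).
Hypothesis GK : lipschitz_set_function G K.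

Let G_null A : measurable A -> fine (mu A) = 0 -> G A = 0.
Proof.
move=> mA A0; apply/eqP; rewrite -normr_le0.
by have := GK mA; rewrite A0 mulr0.
Qed.

Variables (u : {linear Y -> R^o}) (u_cont : continuous u) (c : R).

Let nu A : \bar R := (c * fine (mu A) - u (G A))%:E.

Let nu0 : nu set0 = 0%E.
Proof.
rewrite /nu measure0 G_null//; last by rewrite measure0.
by rewrite linear0 mulr0; congr EFin; exact: subr0.
Qed.

Let nu_fin A : measurable A -> nu A \is a fin_num.
Proof. by []. Qed.

Let nu_sigma : semi_sigma_additive nu.
Proof.
move=> F mF tF mUF.
have GF : series (G \o F) @ \oo --> G (\bigcup_n F n) by exact: G_vm.
have uF : (fun n => u (series (G \o F) n)) @ \oo --> u (G (\bigcup_n F n)).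
  exact: cvg_comp GF (@u_cont _).
have := sum_fine_measure_cvg mF tF => muF.
apply: cvg_EFin => /=; first by near=> n; rewrite sumEFin.
have -> : fine \o (fun n => (\sum_(0 <= i < n) nu (F i))%E) =
    (fun n => c * (\sum_(0 <= i < n) fine (mu (F i))) - u (series (G \o F) n)).
  apply/funext => n; rewrite /= sumEFin/= sumrB mulr_sumr; congr (_ - _).
  by rewrite /series/= linear_sum.
apply: cvgB => //; exact: cvgM (cvg_cst _) muF.
Unshelve. all: by end_near. Qed.

HB.instance Definition _ := isCharge.Build d Omega R nu nu0 nu_fin nu_sigma.

(** A steep mean of G on one set B is inherited, up to equality, by all subsets
    of a piece A of B: take for A a negative set of the charge c mu - u o G that
    carries at least its value on B.  It is not null since G vanishes on null
    sets. *)
Lemma steep_subset B : measurable B -> c * fine (mu B) < u (G B) ->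
  exists A, [/\ measurable A, A `<=` B, (0 < mu A)%E &
    forall S, measurable S -> S `<=` A -> c * fine (mu S) <= u (G S)].
Proof.
move=> mB cB; have [A [AB [mA Aneg] AB']] := hahn_decomposition_lemma nu mB.
exists A; split => //.
  rewrite -mu_fine_gt0// lt_neqAle fine_ge0// andbT; apply/eqP => /esym A0.
  have uA : u (G A) = 0 :> R by rewrite G_null// linear0.
  move: AB'; rewrite lee_fin uA A0 mulr0 subr0 subr_ge0.
  by rewrite leNgt cB.
by move=> S mS SA; have := Aneg S mS SA; rewrite lee_fin subr_le0.
Qed.

End Functional.
End LipschitzVectorMeasure.

(** * Weak-star cluster points in a dual space *)

(** Images under non-surjective maps are needed because the maps of interest
    are bounded sequences of reals. *)
Lemma ultra_fmap (S T : Type) (f : S -> T) (U : set_system S) :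
  UltraFilter U -> UltraFilter (f @ U).
Proof.
move=> UU; split=> [|G PG UG]; first exact: fmap_proper_filter.
apply/seteqP; split => [A GA|]; last exact: UG.
have [//|UA] := in_ultra_setVsetC (f @^-1` A) UU.
have GnA : G (~` A) by apply: UG.
have := @filterI _ _ _ _ _ GA GnA; rewrite setICr => G0.
by case: (filter_not_empty G); exact: G0.
Qed.

Section DualSpace.
Context (R : realType) (E : normedModType R).
Implicit Types (w : dual E) (x : E) (r : R).

Definition dual_eval w : E -> R^o := ns_val w.

Lemma dual_linear w : linear (dual_eval w).
Proof. by have [] := ns_val_carrier w. Qed.

Lemma dual_continuous w : continuous (dual_eval w).
Proof. by have [] := ns_val_carrier w. Qed.

Lemma dual_evalZ w a x : dual_eval w (a *: x) = a *: dual_eval w x.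
Proof.
pose l : {linear E -> R^o} := HB.pack (dual_eval w)
  (GRing.isLinear.Build _ _ _ _ _ (dual_linear w)).
exact: (linearZZ l).
Qed.

Lemma dual_eval_has_sup w :
  has_sup [set `|dual_eval w x| | x in [set x : E | `|x| <= 1]].
Proof.
pose l : {linear E -> R^o} := HB.pack (dual_eval w)
  (GRing.isLinear.Build _ _ _ _ _ (dual_linear w)).
split; first by exists `|dual_eval w 0|, 0 => //=; rewrite normr0.
have /linear_boundedP/pinfty_ex_gt0[r r0 wr] :=
  continuous_linear_bounded (f := l) 0 (@dual_continuous w 0).
exists r => _ [x /= x1 <-]; apply: (le_trans (wr x)).
by rewrite ler_piMr// ltW.
Qed.

Lemma dual_eval_le w x : `|dual_eval w x| <= `|w| * `|x|.
Proof.
have [->|x0] := eqVneq x 0.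
  by rewrite -(scale0r (0 : E)) dual_evalZ !scale0r !normr0 mulr0.
have nx : 0 < `|x| by rewrite normr_gt0.
rewrite -ler_pdivrMr//.
have -> : `|dual_eval w x| / `|x| = `|dual_eval w (`|x|^-1 *: x)|.
  by rewrite dual_evalZ normrZ gtr0_norm ?invr_gt0// mulrC.
apply: (ub_le_sup (dual_eval_has_sup w).2).
exists (`|x|^-1 *: x) => //=.
by rewrite normrZ gtr0_norm ?invr_gt0// mulVf ?gt_eqF.
Qed.

Lemma dual_norm_attained w r : r < `|w| ->
  exists2 x, `|x| <= 1 & r < dual_eval w x.
Proof.
move=> rw; have [_ [x x1 <-]] := sup_gt (dual_eval_has_sup w).1 rw.
have [w0|w0] := leP 0 (dual_eval w x); first by rewrite ger0_norm//; exists x.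
rewrite ltr0_norm// => rx; exists (- x); first by rewrite normrN.
by rewrite -scaleN1r dual_evalZ scaleN1r.
Qed.

Lemma dual_bounded_mem (v : E -> R^o) r : linear v ->
  (forall x, `|v x| <= r * `|x|) -> ns_carrier (dual E) v.
Proof.
move=> lv vr; split => //.
pose l : {linear E -> R^o} := HB.pack v (GRing.isLinear.Build _ _ _ _ _ lv).
apply: (bounded_linear_continuous (f := l)); apply/linear_boundedP.
exists r; split; first exact: num_real.
move=> M rM x; apply: le_trans (vr x) _.
by apply: ler_wpM2r => //; exact: ltW.
Qed.

(** A sequential form of the Banach-Alaoglu theorem: the pointwise limit of the
    sequence along a nonprincipal ultrafilter is again a bounded functional, and
    it inherits every inequality that holds eventually. *)
Lemma bounded_dual_cluster (z : nat -> dual E) r : (forall n, `|z n| <= r) ->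
  exists w : dual E, forall x (c : R) N,
    (forall n, (N <= n)%N -> c <= dual_eval (z n) x) -> c <= dual_eval w x.
Proof.
move=> zr; have [U [UU oU]] := ultraFilterLemma (F := \oo) _.
have PU : ProperFilter U by exact: ultra_proper.
have zx x n : `|dual_eval (z n) x| <= r * `|x|.
  by apply: le_trans (dual_eval_le _ _) _; apply: ler_wpM2r.
have cz x : cvg ((fun n => dual_eval (z n) x) @ U).
  have := @segment_compact R (- (r * `|x|)) (r * `|x|).
  rewrite compact_ultra => /(_ ((fun n => dual_eval (z n) x) @ U)).
  case=> [||y [_ yU]]; first exact: ultra_fmap; last by apply/cvg_ex; exists y.
  have zI n : [set` `[- (r * `|x|), r * `|x|]] (dual_eval (z n) x).
    by rewrite /= in_itv/= -ler_norml.
  exact: (@filterE nat U _ _ zI).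
pose v x : R^o := lim ((fun n => dual_eval (z n) x) @ U).
have lv : linear v.
  move=> a x y; apply: cvg_lim => //.
  have -> : (fun n => dual_eval (z n) (a *: x + y)) =
      (fun n => a *: dual_eval (z n) x + dual_eval (z n) y).
    apply/funext => n; exact: dual_linear.
  apply: cvgD; last exact: cz.
  apply: cvgZl_tmp; exact: cz.
have vr x : `|v x| <= r * `|x|.
  rewrite ler_norml; apply/andP; split.
    by apply: limr_ge; [exact: cz|apply: filterE => n; have := zx x n;
      rewrite ler_norml => /andP[]].
  by apply: limr_le; [exact: cz|apply: filterE => n; have := zx x n;
    rewrite ler_norml => /andP[]].
pose w : dual E := NsElt (mem_set (dual_bounded_mem lv vr)).
exists w => x c N Nc; apply: limr_ge; first exact: cz.
by apply: oU; exists N.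
Qed.

End DualSpace.

(** * Separable duals have almost densities *)

Section SeparableDual.
Context (R : realType) (Y : normedModType R).

Definition dense_sequence (D : nat -> Y) :=
  forall y (eps : R), 0 < eps -> exists n, `|y - D n| < eps.

Lemma linear_continuous_bounded (V W : normedModType R) (f : {linear V -> W}) :
  continuous f -> exists2 C : R, 0 < C & forall v, `|f v| <= C * `|v|.
Proof.
move=> fc.
have /linear_boundedP/pinfty_ex_gt0[C C0 fC] :=
  continuous_linear_bounded 0 (@fc 0).
by exists C.
Qed.

Context d (Omega : measurableType d).
Context (mu : {finite_measure set Omega -> \bar R}).
Variables (G : set Omega -> Y) (G_vm : vector_measure G) (K : R).
Hypothesis GK : lipschitz_set_function mu G K.

Section EvalFunctional.
Variables (E : normedModType R) (f : {linear Y -> dual E}) (e : E).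

Definition eval_functional (y : Y) : R^o := dual_eval (f y) e.

Lemma eval_functional_linear : linear eval_functional.
Proof. by move=> a x y; rewrite /eval_functional linearP. Qed.

HB.instance Definition _ :=
  GRing.isLinear.Build R Y R^o _ eval_functional eval_functional_linear.

Lemma eval_functional_continuous : continuous f -> continuous eval_functional.
Proof.
move=> /linear_continuous_bounded[C C0 fC].
apply: bounded_linear_continuous; apply/linear_boundedP.
exists (C * `|e|); split; first exact: num_real.
move=> M CM y; apply: le_trans (dual_eval_le _ _) _.
rewrite (@le_trans _ _ (C * `|y| * `|e|)) ?ler_wpM2r//.
by rewrite mulrAC ler_wpM2r// ltW.
Qed.

End EvalFunctional.

(** When y is not an almost density on A, some mean of G in A is far from y;
    this is witnessed by evaluation at a single e of the unit ball of E, and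
    steep_subset makes the same e work for all subsets of some A'. *)
Lemma far_subset (E : normedModType R) (f : {linear Y -> dual E}) (eps C : R)
    A y : continuous f -> 0 < C -> (forall v, `|v| <= C * `|f v|) ->
  measurable A -> (0 < mu A)%E -> ~ almost_density mu G eps A y ->
  exists A', [/\ measurable A', A' `<=` A, (0 < mu A')%E & exists2 e : E,
    `|e| <= 1 & forall S, measurable S -> S `<=` A' ->
      (dual_eval (f y) e + eps / C) * fine (mu S) <= dual_eval (f (G S)) e].
Proof.
move=> fc C0 Cf mA A0 nd.
have [B [mB BA yB]] : exists B, [/\ measurable B, B `<=` A &
    eps * fine (mu B) < `|G B - fine (mu B) *: y|].
  apply: contrapT => nB; apply: nd; split => // B mB BA.
  by rewrite leNgt; apply/negP => yB; apply: nB; exists B.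
have : eps / C * fine (mu B) < `|f (G B - fine (mu B) *: y)|.
  by rewrite mulrAC ltr_pdivrMr// [_ * C]mulrC; apply: lt_le_trans yB (Cf _).
move=> /dual_norm_attained[e e1 He].
have [|A' [mA' A'B A'0 HA']] :=
  @steep_subset _ _ _ _ mu G G_vm K GK (eval_functional f e)
    (@eval_functional_continuous _ f e fc) (dual_eval (f y) e + eps / C) B mB.
  rewrite /= mulrDl -ltrBrDl; apply: (lt_le_trans He).
  by rewrite linearB linearZ /= mulrC.
exists A'; split => //; first exact: subset_trans BA.
by exists e.
Qed.

(** Without almost densities, far_subset can be applied successively to the
    members D n of the dense sequence, giving nested sets.  The weak-star
    cluster point w of the means over these sets is then far from the image of
    each D n, which is impossible since w is itself the image of an element
    of Y. *)
Theorem separable_dual_almost_density (D : nat -> Y) (eps : R) :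
  dense_sequence D -> isomorphic_to_dual Y -> 0 < eps -> (0 < mu setT)%E ->
  exists A y, almost_density mu G eps A y.
Proof.
move=> D_dense [E [f [g [fK gK fc gc]]]] eps0 mu0.
apply: contrapT => nd.
have [C1 C10 fC1] := linear_continuous_bounded fc.
have [C2 C20 fC2] : exists2 C : R, 0 < C & forall v, `|v| <= C * `|f v|.
  have gl : linear g.
    by move=> a x y; rewrite -[RHS]fK linearP !gK.
  pose l : {linear dual E -> Y} := HB.pack g (GRing.isLinear.Build _ _ _ _ _ gl).
  have [C C0 lC] := @linear_continuous_bounded _ _ l gc.
  by exists C => // v; have := lC (f v); rewrite /= fK.
have step (nA : nat * set Omega) : exists A', measurable nA.2 ->
    (0 < mu nA.2)%E -> [/\ measurable A', A' `<=` nA.2, (0 < mu A')%E &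
    exists2 e : E, `|e| <= 1 & forall S, measurable S -> S `<=` A' ->
      (dual_eval (f (D nA.1)) e + eps / C2) * fine (mu S) <=
      dual_eval (f (G S)) e].
  have [[mA A0]|nA0] := pselect (measurable nA.2 /\ (0 < mu nA.2)%E); last first.
    by exists set0 => mA A0; exfalso; apply: nA0.
  have [|A' HA'] := @far_subset E f eps C2 nA.2 (D nA.1) fc C20 fC2 mA A0.
    by move=> H; apply: nd; exists nA.2, (D nA.1).
  by exists A'.
have [next nextP] := choice step.
(* As n.+1 is chosen so that the means over its subsets stay away from D n. *)
pose As := fix As n := if n is m.+1 then next (m, As m) else setT.
have As_ok n : measurable (As n) /\ (0 < mu (As n))%E.
  elim: n => [|n [mA A0]]; first by split => //; exact: measurableT.
  by have [] := nextP (n, As n) mA A0.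
have As_nd m n : (m <= n)%N -> As n `<=` As m.
  elim: n => [|n IH]; first by rewrite leqn0 => /eqP ->.
  rewrite leq_eqVlt => /predU1P[->//|]; rewrite ltnS => /IH.
  apply: subset_trans; have [mA A0] := As_ok n.
  by have [] := nextP (n, As n) mA A0.
pose a n := fine (mu (As n.+1)).
have a0 n : 0 < a n by have [mA A0] := As_ok n.+1; rewrite mu_fine_gt0.
pose z n := f ((a n)^-1 *: G (As n.+1)).
have [n|w wz] := @bounded_dual_cluster R E z (C1 * K).
  rewrite (le_trans (fC1 _))// ler_pM2l// normrZ gtr0_norm ?invr_gt0//.
  by rewrite ler_pdivrMl// mulrC; apply: GK; have [] := As_ok n.+1.
have eC0 : 0 < eps / C2 / C1 by rewrite !divr_gt0.
have [n] := D_dense (g w) _ eC0; rewrite ltr_pdivlMr// mulrC; apply/negP.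
rewrite -leNgt (le_trans _ (fC1 _))// linearB gK.
have [mA A0] := As_ok n.
have [_ _ _ [e e1 He]] := nextP (n, As n) mA A0.
suff ew : dual_eval (f (D n)) e + eps / C2 <= dual_eval w e.
  have -> : eps / C2 = dual_eval (f (D n)) e + eps / C2 - dual_eval (f (D n)) e.
    by rewrite addrAC subrr add0r.
  rewrite (@le_trans _ _ (dual_eval (w - f (D n)) e))//; first exact: lerB.
  rewrite (le_trans (ler_norm _))// (le_trans (dual_eval_le _ _))//.
  by rewrite ler_piMr.
apply: (wz _ _ n) => m nm; rewrite /z linearZ/= /dual_eval/=.
rewrite ler_pdivlMl// mulrC; apply: He; first by have [] := As_ok m.+1.
exact: (@As_nd n.+1 m.+1).
Qed.

End SeparableDual.

(** * The Radon-Nikodym property gives almost densities *)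

Section RadonNikodym.
Context (R : realType) (Y : normedModType R).
Context d (Omega : measurableType d).
Context (mu : {finite_measure set Omega -> \bar R}).

(** Stated without measurability because the distance of an arbitrary function
    to a simple one need not be measurable; the integral is then a supremum over
    simple minorants, which is monotone. *)
Lemma ge0_le_integral_pointwise (f1 f2 : Omega -> \bar R) :
  (forall w, 0 <= f1 w)%E -> (forall w, f1 w <= f2 w)%E ->
  (\int[mu]_w f1 w <= \int[mu]_w f2 w)%E.
Proof.
move=> f10 f12; have f20 w : (0 <= f2 w)%E := le_trans (f10 w) (f12 w).
rewrite !ge0_integralTE//; apply: le_ereal_sup => _ [h /= hf1 <-].
by exists h => //= w; apply: le_trans (hf1 w) (f12 w).
Qed.

Lemma simple_function_preimage (s : Omega -> Y) (S : set Y) :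
  simple_function s -> measurable (s @^-1` S).
Proof.
move=> [fs ms]; rewrite (_ : _ @^-1` _ =
    \bigcup_(y in range s `&` S) (s @^-1` [set y])).
  by apply: fin_bigcup_measurable => // ; exact: finite_setIl.
apply/seteqP; split=> [w Sw|w [y [_ Sy] /= ->]//].
by exists (s w) => //; split => //; exists w.
Qed.

(** Only a lower bound for the integral of |g - s| is available when this
    function is not measurable.  It suffices: on B the simple function
    max(|s - y| - eps, 0) is below |g - s|. *)
Lemma simple_integral_near (s g : Omega -> Y) B y (eps : R) :
  simple_function s -> measurable B -> 0 <= eps ->
  (forall w, B w -> `|g w - y| <= eps) ->
  (`|simple_integral mu B s - fine (mu B) *: y|%:E <=
    (eps * fine (mu B))%:E + \int[mu]_w (`|g w - s w|)%:E)%E.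
Proof.
move=> ss mB eps0 gy; have [fs ms] := ss.
pose r := finmap.enum_fset (fset_set (range s)).
pose L v := B `&` s @^-1` [set v].
have mL v : measurable (L v) by exact: measurableI.
pose h v := Num.max (`|v - y| - eps) 0.
have h0 v : 0 <= h v by rewrite le_max lexx orbT.
have muB : fine (mu B) = \sum_(v <- r) fine (mu (L v)).
  have -> : B = \big[setU/set0]_(v \in range s) L v.
    rewrite fsbig_setU//; apply/seteqP; split=> [w Bw|w [v _ []]//].
    by exists (s w) => //; exists w.
  rewrite measure_fsbig//; last exact: trivIset_preimage1_in.
  rewrite fsbig_finite//= -[RHS]/(fine (EFin _)) -sumEFin; congr fine.
  by apply: eq_bigr => v _; rewrite mu_fineK.
have -> : simple_integral mu B s - fine (mu B) *: y =
    \sum_(v <- r) fine (mu (L v)) *: (v - y).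
  rewrite /simple_integral fsbig_finite//= muB scaler_suml -sumrB.
  by apply: eq_bigr => v _; rewrite scalerBr.
apply: (@le_trans _ _ (\sum_(v <- r) fine (mu (L v)) * (eps + h v))%:E).
  rewrite lee_fin; apply: le_trans (ler_norm_sum _ _ _) _.
  apply: ler_sum => v _; rewrite normrZ ger0_norm ?fine_ge0// ler_wpM2l ?fine_ge0//.
  by rewrite -lerBlDl le_max lexx.
rewrite muB mulr_sumr.
have -> : (\sum_(v <- r) fine (mu (L v)) * (eps + h v))%:E =
    ((\sum_(v <- r) eps * fine (mu (L v)))%:E +
    \sum_(v <- r) (h v)%:E * mu (L v))%E.
  rewrite -sumEFin -sumEFin -big_split/=; apply: eq_bigr => v _.
  by rewrite mulrDr EFinD mulrC [_ * h v]mulrC EFinM -(@mu_fineK _ _ _ mu)// EFinM.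
rewrite leeD2l//.
have -> : (\sum_(v <- r) (h v)%:E * mu (L v))%E =
    (\int[mu]_w \sum_(v <- r) (h v * \1_(L v) w)%:E)%E.
  rewrite ge0_integral_sum//.
  - apply: eq_bigr => v _.
    rewrite (@integralZl_indic _ _ _ _ _ _ (fun=> L v))//; last first.
      by rewrite ltNge h0.
    by rewrite integral_indic// setIT.
  - by move=> v; apply/measurable_EFinP; exact: measurable_funM.
  - by move=> v w _; rewrite lee_fin mulr_ge0.
apply: ge0_le_integral_pointwise => w.
  by apply: sume_ge0 => v _; rewrite lee_fin mulr_ge0.
have [Bw|nBw] := pselect (B w); last first.
  rewrite big1 ?lee_fin// => v _; rewrite indicE memNset ?mulr0// => -[].
  by move=> /nBw.
have sr : s w \in r by rewrite in_fset_set// mem_set//; exists w.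
rewrite (bigD1_seq (s w) sr (finmap.fset_uniq _))/= big1 ?adde0.
  rewrite indicE mem_set// mulr1 lee_fin ge_max normr_ge0 andbT.
  rewrite lerBlDr; have -> : s w - y = (s w - g w) + (g w - y).
    by rewrite addrA subrK.
  by rewrite (le_trans (ler_normD _ _))// lerD ?gy// distrC.
by move=> v vs; rewrite indicE memNset ?mulr0// => -[_ /= sv]; rewrite sv eqxx in vs.
Qed.

Variables (G : set Omega -> Y) (G_vm : vector_measure G) (K : R).
Hypothesis GK : lipschitz_set_function mu G K.

Let G_bv : Defs.bounded_variation G.
Proof.
exists (K * fine (mu setT)) => n F mF tF FT.
apply: le_trans (ler_sum _ (fun i _ => GK (mF i))) _.
rewrite -mulr_sumr le_eqVlt; apply/orP; left; apply/eqP; congr (_ * _).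
have -> : mu setT = \sum_(i < n) mu (F i).
  have -> : setT = \big[setU/set0]_(i < n) F i.
    rewrite -FT -bigcup_seq; apply: eq_bigcupl.
    by split=> // i _; rewrite /= mem_index_enum.
  by apply: measure_semi_additive_ord => //; exact: bigsetU_measurable.
rewrite -[LHS]/(fine (EFin _)) -sumEFin; congr fine.
by apply: eq_bigr => i _; rewrite mu_fineK.
Qed.

Let G_cont : mu_continuous mu G.
Proof.
move=> e e0; have K0 : 0 < `|K| + 1 by rewrite ltr_wpDl.
exists (e / (`|K| + 1)); first exact: divr_gt0.
move=> A mA muA.
have Ae : fine (mu A) * (`|K| + 1) < e.
  by rewrite -ltr_pdivlMr// -lte_fin mu_fineK.
apply: le_lt_trans (GK mA) _; apply: le_lt_trans Ae.
rewrite mulrC ler_wpM2l ?fine_ge0//; apply: le_trans (ler_norm _) _.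
by rewrite lerDl.
Qed.

(** Off a null set the simple functions s m converge to g, so almost every point
    lies in one of the countably many sets C k y where s k = y and s m stays
    within eps of y for m >= k.  One of them has positive measure; there g is
    within eps of y, and so are the means of G. *)
Theorem rnp_almost_density (eps : R) : radon_nikodym_property Y ->
  0 < eps -> (0 < mu setT)%E -> exists A y, almost_density mu G eps A y.
Proof.
move=> rnp eps0 mu0.
have [g [[s [ss [N [mN N0 sN]] _]] gG]] := rnp _ _ _ _ G_vm G_bv G_cont.
pose C k y := ~` N `&` s k @^-1` [set y] `&`
  \bigcap_(m in [set m | (k <= m)%N]) (s m @^-1` [set v | `|v - y| <= eps]).
have mC k y : measurable (C k y).
  apply: measurableI.
    apply: measurableI; [exact: measurableC|exact: (ss k).2].
  by apply: bigcap_measurableType => m _; exact: simple_function_preimage.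
have sg w : ~ N w -> s n w @[n --> \oo] --> g w.
  by move=> Nw; apply: contrapT => H; apply: Nw; exact: sN.
have Cg k y w : C k y w -> `|g w - y| <= eps.
  move=> [[Nw _] kw]; have sgy : `|s n w - y| @[n --> \oo] --> `|g w - y|.
    by apply: cvg_norm; apply: cvgB; [exact: sg|exact: cvg_cst].
  apply: (ler_cvg_to sgy (@cvg_cst _ eps _ _ _)).
  by exists k => // n /= kn; exact: kw.
have covered : setT `<=` N `|` \bigcup_k
    \big[setU/set0]_(y <- finmap.enum_fset (fset_set (range (s k)))) C k y.
  move=> w _; have [Nw|Nw] := pselect (N w); [by left|right].
  have e20 : 0 < eps / 2 by rewrite divr_gt0.
  have /cvgrPdist_le/(_ _ e20)[k _ sk] := sg w Nw.
  exists k => //; rewrite -bigcup_seq; exists (s k w).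
    by rewrite /= in_fset_set ?mem_set//; exact: (ss k).1.
  split; first by split.
  move=> m /= km; have -> : s m w - s k w = (s m w - g w) + (g w - s k w).
    by rewrite addrA subrK.
  rewrite (splitr eps) (le_trans (ler_normD _ _))// lerD//; last exact: sk (leqnn k).
  by rewrite distrC; exact: sk.
have [k [y Cky]] : exists k y, (0 < mu (C k y))%E.
  apply: contrapT => C0; move: mu0; rewrite ltNge => /negP; apply.
  suff : mu.-negligible [set: Omega] by move=> /measure_negligible ->.
  apply: negligibleS covered _; apply: negligibleU; first exact/negligibleP.
  apply: negligible_bigcup => k; elim/big_ind: _ => [||y _].
  - exact: negligible_set0.
  - by move=> A B; exact: negligibleU.
  - apply/negligibleP => //; apply/eqP; rewrite eq_le measure_ge0 andbT leNgt.
    by apply/negP => kC; apply: C0; exists k, y.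
exists (C k y), y; split => // B mB BC.
have [s' [ss' _ s'g] s'G] := gG B mB.
have gy w : B w -> `|g w - y| <= eps by move=> /BC; exact: Cg.
rewrite -lee_fin.
have sG : (`|simple_integral mu B (s' n) - fine (mu B) *: y|%:E)
    @[n --> \oo] --> (`|G B - fine (mu B) *: y|%:E)%E.
  apply: cvg_EFin; first exact: nearW.
  by apply: cvg_norm; apply: cvgB => //; exact: cvg_cst.
have sI : ((eps * fine (mu B))%:E + \int[mu]_w (`|g w - s' n w|)%:E)%E
    @[n --> \oo] --> (eps * fine (mu B))%:E.
  rewrite -[X in _ --> X]adde0; apply: cvgeD => //; exact: cvg_cst.
apply: (lee_cvg_to sG sI); apply: nearW => n.
by apply: simple_integral_near => //; exact: ltW.
Qed.

End RadonNikodym.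

(** * The kernel of the averaging operators *)

#[global] Instance ae_leb_filter (R : realType) :
  Filter (nbhs (almost_everywhere (@lebesgue_measure R))).
Proof. exact: (ae_filter_ringOfSetsType (@lebesgue_measure R)). Qed.

#[global] Instance ae_mu_filter (R : realType) I :
  Filter (nbhs (almost_everywhere (mu_on R I))).
Proof. exact: (ae_filter_ringOfSetsType (mu_on R I)). Qed.

Section AveragingKernel.
Context (R : realType) (I : domain).
Local Notation mu := (mu_on R I).
Local Notation leb := (@lebesgue_measure R).
Implicit Types (T : averaging_op) (f g : R -> R) (x t c : R).

(** Both operators have the form
    T|f|(x) = avg_coef x * (integral over avg_set x of |f| * avg_weight). *)
Definition avg_set T x : set R :=
  match T with
  | Cesaro => `[0, x]
  | Copson => dom_set I `&` `[x, +oo[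
  end.

Definition avg_weight T t : R := if T is Cesaro then 1 else t^-1.

Definition avg_coef T x : R := if T is Cesaro then x^-1 else 1.

Lemma averaging_absE T f x : averaging_abs T I f x =
  ((avg_coef T x)%:E *
    \int[leb]_(t in avg_set T x) (`|f t| * avg_weight T t)%:E)%E.
Proof.
case: T; rewrite /averaging_abs /averaging /=; last by rewrite mul1e.
by congr (_ * _)%E; apply: eq_integral => t _; rewrite mulr1.
Qed.

Lemma measurable_avg_set T x : measurable (avg_set T x).
Proof.
case: T => /=; first exact: measurable_itv.
by apply: measurableI; [exact: measurable_dom|exact: measurable_itv].
Qed.

Lemma avg_set_sub T x : dom_set I x -> avg_set T x `<=` dom_set I.
Proof.
case: T => /=; last by move=> _ t [].
case: I => /=; rewrite in_itv/= => /andP[x0 x1] t /=; rewrite !in_itv/= => /andP[t0 tx].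
  by rewrite t0 (le_trans tx).
by rewrite t0.
Qed.

Lemma avg_set_ge0 T x t : avg_set T x t -> 0 <= t.
Proof. by case: T => /=; [rewrite in_itv/= => /andP[]|case=> /dom_ge0]. Qed.

Lemma avg_weight_ge0 T t : 0 <= t -> 0 <= avg_weight T t.
Proof. by case: T => //=; rewrite invr_ge0. Qed.

Lemma avg_coef_ge0 T x : 0 <= x -> 0 <= avg_coef T x.
Proof. by case: T => //=; rewrite invr_ge0. Qed.

Lemma avg_coef_gt0 T x : 0 < x -> 0 < avg_coef T x.
Proof. by case: T => //=; rewrite invr_gt0. Qed.

Lemma measurable_inv_ge0 (D : set R) : measurable D ->
  (forall x, D x -> 0 <= x) -> measurable_fun D (fun x : R => x^-1).
Proof.
move=> mD D0; apply: (eq_measurable_fun (fun x : R => x `^ (-1))).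
  by move=> x /set_mem /D0 x0; rewrite powR_inv1.
by apply: measurable_funTS; exact: measurable_powR.
Qed.

Lemma measurable_avg_integrand T x f : measurable_fun setT f ->
  measurable_fun (avg_set T x) (fun t => (`|f t| * avg_weight T t)%:E).
Proof.
move=> mf; apply/measurable_EFinP; apply: measurable_funM.
  by apply: measurable_funTS; exact: measurableT_comp.
case: T; first exact: measurable_cst.
by apply: measurable_inv_ge0; [exact: measurable_avg_set|exact: avg_set_ge0].
Qed.

Lemma avg_integrand_ge0 T x f t : avg_set T x t ->
  (0 <= (`|f t| * avg_weight T t)%:E)%E.
Proof.
by move=> /avg_set_ge0 t0; rewrite lee_fin mulr_ge0// avg_weight_ge0.
Qed.

Lemma ae_dom : \forall x \ae mu, dom_set I x.
Proof. by apply/ae_mu_on; apply: aeW. Qed.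

Lemma ae_mu_neq t : \forall x \ae mu, x != t.
Proof.
apply/ae_mu_on; exists [set t]; split => //; first exact: lebesgue_measure_set1.
by move=> x /= /not_implyP[_ /negP]; rewrite negbK => /eqP.
Qed.

Lemma ae_pos : \forall x \ae mu, dom_set I x /\ 0 < x.
Proof.
apply: filterS2 ae_dom (ae_mu_neq 0) => x Ix x0; split => //.
by rewrite lt_neqAle eq_sym x0 (dom_ge0 Ix).
Qed.

Lemma averaging_abs_dominated_cvg0 T (f_ : nat -> R -> R) g x :
  (forall n, measurable_fun setT (f_ n)) -> measurable_fun setT g ->
  (\forall t \ae mu, f_ n t @[n --> \oo] --> (0 : R)) ->
  (forall n, \forall t \ae mu, `|f_ n t| <= `|g t|) ->
  dom_set I x -> 0 < x -> averaging_abs T I g x \is a fin_num ->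
  averaging_abs T I (f_ n) x @[n --> \oo] --> 0%E.
Proof.
move=> mf_ mg f0 fg Ix x0; rewrite averaging_absE => gfin.
set J := (\int[_]_(t in _) _)%E in gfin.
have Jfin : (J < +oo)%E.
  rewrite ltey; apply/eqP => Joo; move: gfin.
  by rewrite Joo gt0_muley ?lte_fin ?avg_coef_gt0.
have gint : leb.-integrable (avg_set T x)
    (fun t => (`|g t| * avg_weight T t)%:E).
  apply/integrableP; split; first exact: measurable_avg_integrand.
  rewrite (_ : (\int[_]_(t in _) _)%E = J)//; apply: eq_integral => t /set_mem Kt.
  by rewrite gee0_abs// (avg_integrand_ge0 _ Kt).
have [] := @dominated_convergence _ _ _ leb _ (measurable_avg_set T x)
  (fun n t => (`|f_ n t| * avg_weight T t)%:E) (cst 0%E)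
  (fun t => (`|g t| * avg_weight T t)%:E).
- by move=> n; exact: measurable_avg_integrand.
- exact: measurable_cst.
- move/ae_mu_on : f0; apply: filterS => t ft Kt.
  have {}ft := ft (avg_set_sub Ix Kt).
  apply: cvg_EFin; first exact: nearW.
  have := cvgM (cvg_norm ft) (cvg_cst (avg_weight T t)).
  by rewrite normr0 mul0r; apply.
- exact: gint.
- have : \forall t \ae leb, forall n, dom_set I t -> `|f_ n t| <= `|g t|.
    by apply/ae_foralln => n; exact/ae_mu_on.
  apply: filterS => t h n Kt; have t0 := avg_set_ge0 Kt.
  rewrite gee0_abs ?(avg_integrand_ge0 _ Kt)// lee_fin ler_wpM2r ?avg_weight_ge0//.
  exact/h/(avg_set_sub Ix Kt).
move=> _ _; rewrite integral0 => h.
have := cvgeZl (_ : (avg_coef T x)%:E \is a fin_num) h; rewrite mule0 => /(_ isT).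
by apply: cvg_trans; apply: near_eq_cvg; apply: nearW => n; rewrite averaging_absE.
Qed.

End AveragingKernel.

(** * Profiles: the shape of T at a point mass *)

Section Profile.
Context (R : realType) (I : domain).
Local Notation mu := (mu_on R I).
Local Notation leb := (@lebesgue_measure R).
Implicit Types (T : averaging_op) (f g : R -> R) (x t c : R) (B : set R).

Definition reach T c : set R :=
  dom_set I `&` if T is Cesaro then [set` `[c, +oo[] else [set` `]-oo, c]].

(** Up to the factor avg_weight c, this is the operator applied to a unit mass
    at c, as a function of x; reach T c is the set of x whose average sees c. *)
Definition profile T c : R -> R := (avg_coef T : R -> R) \_ (reach T c).

Lemma measurable_reach T c : measurable (reach T c).
Proof.
by apply: measurableI; [exact: measurable_dom|case: T; exact: measurable_itv].
Qed.

Lemma measurable_profile T c : measurable_fun [set: R] (profile T c).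
Proof.
have mr := measurable_reach T c.
apply: (measurable_restrictT (avg_coef T : R -> R) mr).1.
move: mr; case: T => mr; last exact: measurable_cst.
by apply: measurable_inv_ge0; [exact: mr|move=> x [/dom_ge0]].
Qed.

Lemma profile_ge0 T c x : 0 <= profile T c x.
Proof.
rewrite /profile patchE; case: ifPn => // /set_mem[/dom_ge0 x0 _].
exact: avg_coef_ge0.
Qed.

Lemma avg_set_reach T c x : reach T c x -> avg_set I T c `<=` avg_set I T x.
Proof.
case: T => -[Ix] /=; rewrite in_itv/= ?andbT => cx t /=; rewrite !in_itv/= ?andbT.
  by move=> /andP[-> /le_trans->].
by move=> [It ct]; split => //; apply: le_trans ct.
Qed.

Lemma profile_minorant T f c : measurable_fun setT f -> dom_set I c ->
  (0 < averaging_abs T I f c)%E ->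
  exists2 r, 0 < r & forall x, dom_set I x ->
    ((r * profile T c x)%:E <= averaging_abs T I f x)%E.
Proof.
move=> mf Ic; rewrite averaging_absE; set J := (\int[_]_(t in _) _)%E => J0.
have {}J0 : (0 < J)%E.
  rewrite lt_neqAle eq_sym; apply/andP; split.
    by apply/eqP => J00; move: J0; rewrite J00 mule0 ltxx.
  by apply: integral_ge0 => t; exact: avg_integrand_ge0.
(* The integral may be infinite, so a finite minorant r is used instead. *)
have [r r0 rJ] : exists2 r : R, 0 < r & (r%:E <= J)%E.
  move: J0; case: J => [r| |//]; first by rewrite lte_fin => r0; exists r.
  by move=> _; exists 1 => //; rewrite leey.
exists r => // x Ix; rewrite /profile patchE; case: ifPn => [/set_mem cx|_].
  rewrite averaging_absE mulrC EFinM; apply: lee_wpmul2l.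
    by rewrite lee_fin avg_coef_ge0// (dom_ge0 Ix).
  apply: le_trans rJ _; apply: ge0_subset_integral.
  - exact: measurable_avg_set.
  - exact: measurable_avg_set.
  - exact: measurable_avg_integrand.
  - by move=> t; exact: avg_integrand_ge0.
  - exact: avg_set_reach.
by rewrite mulr0 averaging_abs_ge0.
Qed.

Lemma averaging_abs_eq0_on T f c : measurable_fun setT f -> dom_set I c ->
  0 < c -> averaging_abs T I f c = 0%E ->
  \forall t \ae leb, avg_set I T c t -> f t = 0.
Proof.
move=> mf Ic c0; rewrite averaging_absE => /eqP.
rewrite mule_eq0 eqe gt_eqF ?avg_coef_gt0//= => /eqP J0.
have : (\int[leb]_(t in avg_set I T c) `|(`|f t| * avg_weight T t)%:E| = 0)%E.
  rewrite -J0; apply: eq_integral => t /set_mem Kt.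
  by rewrite gee0_abs// (avg_integrand_ge0 _ Kt).
move=> /(ae_eq_integral_abs leb (measurable_avg_set I T c)
  (measurable_avg_integrand mf)).
have n0 : \forall t \ae leb, t != 0 :> R.
  exists [set 0]; split => //; first exact: lebesgue_measure_set1.
  by move=> t /= /negP; rewrite negbK => /eqP.
apply: filterS2 n0 => t t0 h Kt; have := h Kt => /= -[] /eqP.
rewrite mulf_eq0 normr_eq0 => /orP[/eqP//|].
by case: (T) => /=; [rewrite oner_eq0|rewrite invr_eq0 (negbTE t0)].
Qed.

(** An average that sees some point of [a, b] sees near_end; one that sees
    far_end sees all of [a, b]. *)
Definition near_end T (a b : R) := if T is Cesaro then a else b.
Definition far_end T (a b : R) := if T is Cesaro then b else a.

Section Indicator.
Variables (a b : R) (a0 : 0 < a) (Ib : dom_set I b).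
Variables (B : set R) (mB : measurable B) (Bab : B `<=` [set` `[a, b]]).

Let abI : [set` `[a, b]] `<=` dom_set I.
Proof.
move: Ib; case: (I) => /=; rewrite in_itv/= => /andP[b0 b1] t /=;
  rewrite !in_itv/= => /andP[at_ tb].
  by rewrite (le_trans (ltW a0) at_) (le_trans tb).
by rewrite (le_trans (ltW a0) at_).
Qed.

Let lebB : (fine (leb B))%:E = leb B.
Proof.
rewrite fineK// ge0_fin_numE//; apply: (@le_lt_trans _ _ (leb [set` `[a, b]])).
  by apply: le_measure; rewrite ?inE//; exact: measurable_itv.
by rewrite lebesgue_measure_itv; case: ifP => //= _; rewrite -EFinB ltry.
Qed.

Let m1B : measurable_fun setT (\1_B : R -> R).
Proof. exact: measurable_indic. Qed.

Let integral_cst_indic (r : R) (D : set R) : measurable D -> 0 <= r ->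
  (\int[leb]_(t in D) (r * \1_B t)%:E)%E = (r%:E * leb (B `&` D))%E.
Proof.
move=> mD r0; have := @integralZl_indic _ _ R leb D mD (fun=> B) r _ mB.
rewrite integral_indic//; apply.
by rewrite ltNge r0.
Qed.

Lemma averaging_indic_le T x : dom_set I x ->
  (averaging_abs T I \1_B x <=
   ((1 + a^-1) * fine (leb B) * profile T (near_end T a b) x)%:E)%E.
Proof.
move=> Ix; have M0 : 0 <= 1 + a^-1 by rewrite addr_ge0// invr_ge0 ltW.
rewrite averaging_absE /profile patchE; case: ifPn => [_|nx].
  rewrite mulrC EFinM; apply: lee_wpmul2l.
    by rewrite lee_fin avg_coef_ge0// (dom_ge0 Ix).
  rewrite EFinM lebB.
  apply: (@le_trans _ _ (\int[leb]_(t in avg_set I T x)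
      ((1 + a^-1) * \1_B t)%:E)%E).
    apply: ge0_le_integral.
    - exact: measurable_avg_set.
    - by move=> t; exact: avg_integrand_ge0.
    - exact: measurable_avg_integrand.
    - apply/measurable_EFinP; apply: measurable_funTS.
      exact: measurable_funM.
    - move=> t _; rewrite lee_fin mulrC indicE; have [/set_mem Bt|] := boolP (t \in B).
        rewrite normr1 !mulr1; have /= := Bab Bt; rewrite in_itv/= => /andP[at_ _].
        case: (T) => /=; first by rewrite lerDl invr_ge0 ltW.
        rewrite (@le_trans _ _ a^-1)// ?lerDr// lef_pV2// posrE//.
        exact: lt_le_trans at_.
      by rewrite normr0 !mulr0.
  rewrite integral_cst_indic//; last exact: measurable_avg_set.
  apply: lee_wpmul2l; first by rewrite lee_fin.
  apply: le_measure; rewrite ?inE//.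
  by apply: measurableI => //; exact: measurable_avg_set.
rewrite mulr0 integral0_eq ?mule0// => t Kt; rewrite indicE memNset ?normr0 ?mul0r//.
move=> /Bab /=; rewrite in_itv/= => /andP[at_ tb].
move/negP: nx; apply; apply/mem_set; split => //.
case: (T) Kt => /=; rewrite !in_itv/= ?andbT.
  by move=> /andP[_ tx]; apply: le_trans tx.
by move=> [_ xt]; apply: le_trans tb.
Qed.

Lemma averaging_indic_ge T x : dom_set I x ->
  (((1 + b)^-1 * fine (leb B) * profile T (far_end T a b) x)%:E <=
   averaging_abs T I \1_B x)%E.
Proof.
move=> Ix; have b0 := dom_ge0 Ib.
have m0 : 0 <= (1 + b)^-1 by rewrite invr_ge0 addr_ge0.
rewrite averaging_absE /profile patchE; case: ifPn => [/set_mem[_ xr]|nx].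
  rewrite mulrC EFinM; apply: lee_wpmul2l.
    by rewrite lee_fin avg_coef_ge0// (dom_ge0 Ix).
  rewrite EFinM lebB.
  have -> : leb B = leb (B `&` avg_set I T x).
    congr (leb _); apply/esym/setIidl => t /Bab abt; have It := abI abt.
    move: abt xr; rewrite /= in_itv/= => /andP[at_ tb].
    case: (T) => /=; rewrite !in_itv/= ?andbT.
      by move=> bx; rewrite (le_trans (ltW a0) at_) (le_trans tb).
    by move=> xa; split => //; apply: le_trans at_.
  rewrite -integral_cst_indic//; last exact: measurable_avg_set.
  apply: ge0_le_integral.
  - exact: measurable_avg_set.
  - by move=> t _; rewrite lee_fin mulr_ge0.
  - apply/measurable_EFinP; apply: measurable_funTS; exact: measurable_funM.
  - exact: measurable_avg_integrand.
  - move=> t _; rewrite lee_fin mulrC indicE; have [/set_mem Bt|] := boolP (t \in B).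
      rewrite normr1 !mul1r; have /= := Bab Bt; rewrite in_itv/= => /andP[at_ tb].
      case: (T) => /=; first by rewrite invf_le1 ?lerDl// ltr_wpDr.
      have t0 : 0 < t by exact: lt_le_trans at_.
      by rewrite lef_pV2 ?posrE ?ltr_wpDr// (le_trans tb)// lerDr.
    by rewrite normr0 !mul0r.
rewrite mulr0 -averaging_absE; exact: averaging_abs_ge0.
Qed.

End Indicator.
End Profile.

(** * Dominated convergence in X and TX *)

Section TXSpace.
Context (R : realType) (I : domain) (T : averaging_op).
Local Notation mu := (mu_on R I).
Local Notation leb := (@lebesgue_measure R).
Implicit Types (f g : L0 mu) (h : R -> R).

Lemma measurable_L0 f : measurable_fun [set: R] (f : R -> R).
Proof. exact: (measurable_funP (repr f)). Qed.

Lemma L0_restrictE f (A : set (measurableTypeR R)) (mA : measurable A) :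
  \forall x \ae mu, L0_restrict f mA x = f x * (x \in A)%:R.
Proof. exact: toL0K. Qed.

(** A total function avoids carrying measurability proofs in terms. *)
Definition L0_class h : L0 mu := xget 0 [set f : L0 mu | \forall x \ae mu, f x = h x].

Lemma L0_classE h : measurable_fun [set: R] h ->
  \forall x \ae mu, L0_class h x = h x.
Proof.
move=> mh; rewrite /L0_class.
pose h' : {mfun (measurableTypeR R) >-> R} :=
  @mfun_Sub _ _ (measurableTypeR R) R _ (mem_set mh).
have ex : exists f : L0 mu, \forall x \ae mu, f x = h x.
  by exists (toL0 mu h'); exact: toL0K.
by have := xgetPex (0 : L0 mu) ex.
Qed.

Variable X : banachFunctionSpace R I.
Local Notation Y := (TX T X).

Lemma X_ideal f g : ns_carrier X g -> (\forall x \ae mu, `|f x| <= `|g x|) ->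
  ns_carrier X f /\ ns_norm X f <= ns_norm X g.
Proof. by move=> Xg fg; exact: (bfs_ideal fg Xg). Qed.

Lemma TX_normE f g : ae_represents g (averaging_abs T I f) ->
  ns_norm Y f = ns_norm X g.
Proof.
move=> gf; rewrite -[LHS]/(TX_norm T X f) /TX_norm; congr ns_norm; case: xgetP => [g' _ /= g'f|/(_ g)//].
exact: ae_represents_uniq g'f gf.
Qed.

Lemma TX_dominated f g : ns_carrier X g ->
  (\forall x \ae mu, (averaging_abs T I f x <= (g x)%:E)%E) ->
  ns_carrier Y f /\ ns_norm Y f <= ns_norm X g.
Proof.
move=> Xg fg.
have [h hf] : exists h : L0 mu, ae_represents h (averaging_abs T I f).
  apply: ae_represents_ex.
    by apply: measurable_averaging_abs; exact: measurable_L0.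
  apply: filterS2 fg (ae_dom R I) => x fgx Ix.
  by rewrite ge0_fin_numE ?averaging_abs_ge0// (le_lt_trans fgx) ?ltry.
have [Xh hg] : ns_carrier X h /\ ns_norm X h <= ns_norm X g.
  apply: X_ideal Xg _; apply: filterS3 fg hf (ae_dom R I) => x + hx Ix.
  have := averaging_abs_ge0 T f Ix; rewrite hx !lee_fin => h0 hg.
  by rewrite !ger0_norm// (le_trans h0).
by split; [exists h|rewrite (TX_normE hf)].
Qed.

Lemma TX_ideal f g : ns_carrier Y g -> (\forall x \ae mu, `|f x| <= `|g x|) ->
  ns_carrier Y f /\ ns_norm Y f <= ns_norm Y g.
Proof.
move=> [h Xh hg] fg; rewrite (TX_normE hg); apply: TX_dominated => //.
apply: filterS2 hg (ae_dom R I) => x <- Ix.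
by apply: le_averaging_abs => //; exact: measurable_L0.
Qed.

Lemma X_norm_ge0 f : ns_carrier X f -> 0 <= ns_norm X f.
Proof.
move=> Xf; exact: (normr_ge0 (NsElt (mem_set Xf : f \in ns_pred X))).
Qed.

(** Order continuity speaks of sets only.  Functions g_ m that are dominated by
    g and tend to 0 are below del * |g| outside the set A n, for m >= n, and the
    sets A n decrease to the empty set once a null set N is removed. *)
Lemma X_dominated_cvg0 (g_ : nat -> L0 mu) g : order_continuous X ->
  ns_carrier X g -> (forall n, \forall x \ae mu, `|g_ n x| <= `|g x|) ->
  (\forall x \ae mu, g_ n x @[n --> \oo] --> (0 : R)) ->
  ns_norm X (g_ n) @[n --> \oo] --> (0 : R).
Proof.
move=> X_oc Xg gg g0.
have Xgn n : ns_carrier X (g_ n) by have [] := X_ideal Xg (gg n).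
have := filterI g0 (filterI (ae_dom R I) (ae_foralln gg)).
move=> [N [mN N0 gN]].
apply/cvgrPdist_le => e e0.
pose del := e / 2 / (ns_norm X g + 1).
have g10 : 0 < ns_norm X g + 1 by rewrite ltr_wpDl// X_norm_ge0.
have del0 : 0 < del by rewrite !divr_gt0.
pose A n := (dom_set I `\` N) `&`
  \bigcup_(m in [set m | (n <= m)%N]) [set x | del * `|g x| < `|g_ m x|].
have mA n : measurable (A n : set (measurableTypeR R)).
  apply: measurableI.
    by apply: measurableD => //; exact: measurable_dom.
  apply: bigcup_measurable => m _.
  have mgt : measurable_fun [set: R] (fun x => (del * `|g x| < `|g_ m x|)).
    apply: measurable_fun_ltr.
      by apply: measurable_funM => //; apply: measurableT_comp => //; exact: measurable_L0.
    by apply: measurableT_comp => //; exact: measurable_L0.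
  rewrite -[X in measurable X]setTI; exact: (mgt measurableT [set true]).
have AI n : A n `<=` dom_set I by move=> x [[]].
have And n : A n.+1 `<=` A n.
  by move=> x [Ix [m /= nm gx]]; split => //; exists m => //=; exact: ltnW.
have A0 : \bigcap_n A n = set0.
  apply/seteqP; split => // x Ax; have [[Ix Nx] _] := Ax 0%N Logic.I.
  have [gx0 [_ gx]] : (g_ n x @[n --> \oo] --> (0 : R)) /\ dom_set I x /\
    forall n, `|g_ n x| <= `|g x| by apply: contrapT => H; apply: Nx; exact: gN.
  have [gx00|gx00] := eqVneq (g x) 0.
    have [_ [m _ /=]] := Ax 0%N Logic.I.
    by rewrite gx00 normr0 mulr0 ltNge (le_trans (gx m))// gx00 normr0.
  have dg0 : 0 < del * `|g x| by rewrite mulr_gt0// normr_gt0.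
  have /cvgrPdist_le/(_ _ dg0)[n _ ng] := gx0.
  have [_ [m /= nm]] := Ax n Logic.I; have := ng m nm.
  by rewrite sub0r normrN leNgt => /negP.
have := X_oc g A mA Xg AI And A0.
have e20 : 0 < e / 2 by rewrite divr_gt0.
move=> /cvgrPdist_le/(_ _ e20)[n _ Hn]; exists n => // m /= nm.
have Xr : ns_carrier X (L0_restrict g (mA m)).
  apply: (X_ideal Xg _).1; apply: filterS (L0_restrictE g (mA m)) => x ->.
  by rewrite normrM; case: (x \in A m); rewrite ?normr1 ?mulr1// normr0 mulr0.
have := Hn m nm; rewrite !sub0r !normrN !ger0_norm ?X_norm_ge0// => rm.
have Xdr : ns_carrier X (del *: g + L0_restrict g (mA m)).
  by apply: ns_add => //; exact: ns_scale.
have gX : \forall x \ae mu, `|g_ m x| <=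
    `|((del *: g + L0_restrict g (mA m))%R : L0 mu) x|.
  have NN : \forall x \ae mu, ~ N x.
    by exists N; split => // x /= /contrapT.
  apply: filterS3 (filterI NN (filterI (ae_dom R I) (gg m)))
    (filterI (L0_DE (del *: g) (L0_restrict g (mA m))) (L0_ZE del g))
    (L0_restrictE g (mA m)) => x [Nx [Ix gx]] [-> ->] ->.
  have [xA|xA] := boolP (x \in A m).
    rewrite mulr1 -[X in _ + X]mul1r -mulrDl normrM.
    have d1 : 1 <= `|del + 1| by rewrite (le_trans _ (ler_norm _))// lerDr ltW.
    by rewrite (le_trans gx)// ler_peMl.
  rewrite mulr0 addr0 normrM gtr0_norm// leNgt; apply/negP => lt.
  by move/negP: xA; apply; apply/mem_set; split => //; exists m => /=.
have [_ le1] := X_ideal Xdr gX.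
have := ns_normD (ns_scale del Xg) Xr; rewrite ns_normZ// gtr0_norm// => le2.
have : del * ns_norm X g <= e / 2.
  by rewrite /del mulrAC ler_pdivrMr// ler_wpM2l ?lerDl// ltW.
by lra.
Qed.

(** T|f_ n| tends to 0 almost everywhere by dominated convergence for the
    integral defining T, and it is dominated by T|g|; so dominated convergence
    passes from X to TX. *)
Lemma TX_order_continuous (f_ : nat -> L0 mu) g : order_continuous X ->
  ns_carrier Y g -> (forall n, \forall x \ae mu, `|f_ n x| <= `|g x|) ->
  (\forall x \ae mu, f_ n x @[n --> \oo] --> (0 : R)) ->
  ns_norm Y (f_ n) @[n --> \oo] --> (0 : R).
Proof.
move=> X_oc Yg fg f0; have [h Xh hg] := Yg.
have fh n : exists k : L0 mu, ae_represents k (averaging_abs T I (f_ n)).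
  by have [[k _ kf] _] := TX_ideal Yg (fg n); exists k.
have [k kf] := choice fh.
have -> : (fun n => ns_norm Y (f_ n)) = (fun n => ns_norm X (k n)).
  by apply/funext => n; exact: TX_normE.
apply: X_dominated_cvg0 X_oc Xh _ _.
  move=> n; apply: filterS3 hg (kf n) (ae_dom R I) => x hx kx Ix.
  have := averaging_abs_ge0 T (f_ n) Ix.
  have : (averaging_abs T I (f_ n) x <= averaging_abs T I g x)%E.
    by apply: le_averaging_abs => //; exact: measurable_L0.
  rewrite hx kx !lee_fin => le1 le0; rewrite !ger0_norm//.
  exact: le_trans le1.
have kf' : \forall x \ae mu, forall n, averaging_abs T I (f_ n) x = (k n x)%:E.
  exact: ae_foralln.
apply: filterS3 hg kf' (ae_pos R I) => x hx kx [Ix x0].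
have : averaging_abs T I (f_ n) x @[n --> \oo] --> 0%E.
  apply: (@averaging_abs_dominated_cvg0 _ _ _ _ g) => //.
  - by move=> n; exact: measurable_L0.
  - exact: measurable_L0.
  - by rewrite hx.
move=> /fine_cvg; apply: cvg_trans; apply: near_eq_cvg; apply: nearW => n.
by rewrite /= kx.
Qed.

End TXSpace.

(** * Good intervals *)

Section GoodIntervals.
Context (R : realType) (I : domain) (T : averaging_op).
Context (X : banachFunctionSpace R I).
Local Notation mu := (mu_on R I).
Local Notation leb := (@lebesgue_measure R).
Local Notation Y := (TX T X).
Implicit Types (f g : L0 mu) (h : R -> R) (a b c t x : R) (B : set R).

Definition dom_inner : set R :=
  if I is UnitInterval then [set` `]0, 1[] else [set` `]0, +oo[].

Lemma dom_inner_dom : dom_inner `<=` dom_set I.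
Proof.
rewrite /dom_inner; case: I => x /=; rewrite !in_itv/= ?andbT.
  by move=> /andP[/ltW-> /ltW->].
by move=> /ltW.
Qed.

Lemma dom_inner_gt0 x : dom_inner x -> 0 < x.
Proof. by rewrite /dom_inner; case: I => /=; rewrite in_itv/= ?andbT => // /andP[]. Qed.

Lemma dom_inner_between x y z : dom_inner x -> dom_inner y -> x <= z <= y ->
  dom_inner z.
Proof.
rewrite /dom_inner; case: I => /=; rewrite !in_itv/= ?andbT; last first.
  by move=> x0 _ /andP[xz _]; exact: lt_le_trans xz.
move=> /andP[x0 _] /andP[_ y1] /andP[xz zy].
by rewrite (lt_le_trans x0 xz) (le_lt_trans zy y1).
Qed.

Lemma dom_inner_above x : dom_inner x -> exists2 y, dom_inner y & x < y.
Proof.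
rewrite /dom_inner; case: I => /=; rewrite !in_itv/= ?andbT.
  by move=> /andP[x0 x1]; exists ((x + 1) / 2); rewrite ?in_itv/=; lra.
by move=> x0; exists (x + 1); rewrite ?in_itv/= ?andbT; lra.
Qed.

Lemma dom_inner_below x : dom_inner x -> exists2 y, dom_inner y & y < x.
Proof.
rewrite /dom_inner; case: I => /=; rewrite !in_itv/= ?andbT.
  by move=> /andP[x0 x1]; exists (x / 2); rewrite ?in_itv/=; lra.
by move=> x0; exists (x / 2); rewrite ?in_itv/= ?andbT; lra.
Qed.

Lemma ae_dom_inner : \forall x \ae mu, dom_inner x.
Proof.
apply: filterS3 (ae_dom R I) (ae_mu_neq I 0) (ae_mu_neq I 1) => x.
rewrite /dom_inner; case: I => /=; rewrite !in_itv/= ?andbT => + x0 x1.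
  by rewrite !lt_neqAle x1 eq_sym x0.
by rewrite lt_neqAle eq_sym x0.
Qed.

(** This fails at c = 1 in the unit interval for the Cesaro operator, which is
    why the ends of good intervals are taken in the interior. *)
Lemma profile_not_ae0 c : dom_inner c -> ~ \forall x \ae mu, profile I T c x = 0.
Proof.
move=> Ic /ae_mu_on[A [mA A0 PA]].
have [u [v [uv uvr]]] : exists u v : R, u < v /\
    forall x, u < x < v -> reach I T c x /\ 0 < x.
  have c0 := dom_inner_gt0 Ic; case: T; last first.
    exists 0, c; split => // x /andP[x0 xc]; split => //; split; last first.
      by rewrite /= in_itv/= ltW.
    have x0' := ltW x0; have := dom_inner_dom Ic.
    case: I => /=; rewrite !in_itv/= x0' ?andbT//=.
    by move=> /andP[_]; apply: le_trans; exact: ltW.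
  have [v Iv cv] := dom_inner_above Ic; exists c, v; split => // x /andP[cx xv].
  have x0 : 0 < x by exact: lt_trans cx.
  split => //; split; last by rewrite /= in_itv/= andbT; exact: ltW.
  by apply: dom_inner_dom; apply: (@dom_inner_between c v x) => //; rewrite !ltW.
have : (leb [set` `]u, v[] <= leb A)%E.
  apply: le_measure; rewrite ?inE//.
  move=> x /= ; rewrite in_itv/= => /uvr[rx x0]; apply: PA => /= /(_ rx.1).
  rewrite /profile patchE mem_set// => /eqP.
  by rewrite gt_eqF// avg_coef_gt0.
by rewrite A0 lebesgue_measure_itv/= lte_fin uv -EFinB lee_fin subr_le0 leNgt uv.
Qed.

Definition good_itv a b := [/\ dom_inner a, dom_inner b, a < b &
  ns_carrier X (L0_class I (profile I T (near_end T a b)))].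

Lemma averaging_abs_L0_class h x : measurable_fun [set: R] h -> dom_set I x ->
  averaging_abs T I (L0_class I h) x = averaging_abs T I h x.
Proof.
move=> mh Ix; have he := L0_classE I mh; apply/eqP; rewrite eq_le.
by apply/andP; split; apply: le_averaging_abs => //; try exact: measurable_L0;
  apply: filterS he => t ->.
Qed.

(** Together with good_indic_ge this says that TX restricted to indicators of
    subsets of [a, b] looks like L^1. *)
Lemma good_indic_le a b : good_itv a b -> exists K : R, forall B, measurable B ->
  B `<=` [set` `[a, b]] -> ns_carrier Y (L0_class I \1_B) /\
  ns_norm Y (L0_class I \1_B) <= K * fine (leb B).
Proof.
move=> [Ia Ib ab XV]; have a0 := dom_inner_gt0 Ia.
exists ((1 + a^-1) * ns_norm X (L0_class I (profile I T (near_end T a b)))).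
move=> B mB Bab.
have m1B : measurable_fun [set: R] (\1_B : R -> R) by exact: measurable_indic.
pose c := (1 + a^-1) * fine (leb B).
have c0 : 0 <= c by rewrite mulr_ge0 ?fine_ge0// addr_ge0// invr_ge0 ltW.
rewrite mulrAC -/c -(ger0_norm c0) -ns_normZ//.
apply: TX_dominated; first exact: ns_scale.
have VE := L0_classE I (measurable_profile I T (near_end T a b)).
set V := L0_class I (profile I T _) in XV VE *.
apply: filterS3 (ae_dom R I) (L0_ZE c V) VE => x Ix -> ->.
by rewrite averaging_abs_L0_class//; exact: averaging_indic_le.
Qed.

Lemma good_indic_ge a b : good_itv a b -> exists2 k : R, 0 < k &
  forall B, measurable B -> B `<=` [set` `[a, b]] ->
  k * fine (leb B) <= ns_norm Y (L0_class I \1_B).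
Proof.
move=> gab; have [Ia Ib ab XV] := gab; have a0 := dom_inner_gt0 Ia.
have [K HK] := good_indic_le gab.
pose V := L0_class I (profile I T (far_end T a b)).
pose m := (1 + b)^-1.
have m0 : 0 < m by rewrite invr_gt0 addr_gt0// (lt_trans a0).
have VE := L0_classE I (measurable_profile I T (far_end T a b)).
have VB B : measurable B -> B `<=` [set` `[a, b]] -> exists2 h : L0 mu,
    ns_carrier X h & ns_norm Y (L0_class I \1_B) = ns_norm X h /\
    \forall x \ae mu, `|((m * fine (leb B)) *: V : L0 mu) x| <= `|h x|.
  move=> mB Bab; have [[h Xh hB] _] := HK B mB Bab; exists h => //.
  split; first exact: TX_normE.
  apply: filterS3 (filterI hB (ae_dom R I)) (L0_ZE (m * fine (leb B)) V) VE.
  move=> x [hx Ix] -> ->.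
  have := averaging_indic_ge a0 (dom_inner_dom Ib) mB Bab T Ix.
  rewrite -averaging_abs_L0_class// hx lee_fin -/m => le1; rewrite ger0_norm ?(le_trans le1) ?ler_norm//.
  by rewrite !mulr_ge0 ?fine_ge0 ?profile_ge0// ltW.
have XVf : ns_carrier X V.
  have mab : measurable [set` `[a, b]] by exact: measurable_itv.
  have [h Xh [_ hV]] := VB _ mab (@subset_refl _ _).
  have [Xs _] := X_ideal Xh hV.
  have := ns_scale (m * fine (leb [set` `[a, b]]))^-1 Xs.
  rewrite scalerA mulVf ?scale1r// gt_eqF// mulr_gt0//.
  by rewrite lebesgue_measure_itv/= lte_fin ab/= subr_gt0.
exists (m * ns_norm X V).
  rewrite mulr_gt0// lt_neqAle X_norm_ge0// andbT eq_sym; apply/eqP => V0.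
  have Vf0 := ns_norm0 XVf V0.
  apply: (@profile_not_ae0 (far_end T a b)); first by rewrite /far_end; case: T.
  by apply: filterS2 VE (L0_0E mu) => x <-; rewrite -/V Vf0.
move=> B mB Bab; have [h Xh [-> hV]] := VB B mB Bab.
have [_] := X_ideal Xh hV; rewrite ns_normZ//.
by rewrite ger0_norm ?mulr_ge0 ?fine_ge0// ?(ltW m0)// mulrAC.
Qed.

Lemma profile_mem f c : ns_carrier Y f -> dom_inner c ->
  (0 < averaging_abs T I f c)%E -> ns_carrier X (L0_class I (profile I T c)).
Proof.
move=> [g Xg gf] Ic fc.
have [r r0 rV] := profile_minorant (measurable_L0 f) (dom_inner_dom Ic) fc.
apply: (X_ideal (ns_scale r^-1 Xg) _).1.
apply: filterS3 (filterI gf (ae_dom R I)) (L0_ZE r^-1 g)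
  (L0_classE I (measurable_profile I T c)) => x [gx Ix] -> ->.
have := rV x Ix; rewrite gx lee_fin => le1.
rewrite ger0_norm ?profile_ge0// normrM gtr0_norm ?invr_gt0// ler_pdivlMl//.
by rewrite (le_trans le1)// ler_norm.
Qed.

(** A point t is covered as soon as T|f|(q) > 0 for some rational q <= t (Cesaro)
    or q >= t (Copson), since then the profile of q is in X.  If T|f|(q) = 0,
    then f = 0 almost everywhere on the set over which T averages at q.  Hence,
    off a null set, the uncovered points of the support form a set E with no
    rational between two of its elements: at most one point. *)
Lemma ae_support_good f : ns_carrier Y f -> \forall t \ae mu, f t <> 0 ->
  exists p : rat * rat, good_itv (ratr p.1) (ratr p.2) /\ ratr p.1 <= t <= ratr p.2.
Proof.
move=> Yf.
pose before (q : rat) t := if T is Cesaro then ratr q <= t else t <= ratr q.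
pose P t := dom_inner t /\ forall q : rat, dom_inner (ratr q) ->
  averaging_abs T I f (ratr q) = 0%E -> avg_set I T (ratr q) t -> f t = 0.
have aeP : \forall t \ae mu, P t.
  have Q (n : nat) : \forall t \ae mu, forall q : rat, unpickle n = Some q ->
      dom_inner (ratr q) -> averaging_abs T I f (ratr q) = 0%E ->
      avg_set I T (ratr q) t -> f t = 0.
    case: (@unpickle rat n) => [q|]; last by apply: aeW.
    have [[Iq fq]|nq] := pselect (dom_inner (ratr q) /\
      averaging_abs T I f (ratr q) = 0%E); last first.
      by apply: aeW => t q' [<-] Iq fq; exfalso; apply: nq.
    have := averaging_abs_eq0_on (measurable_L0 f) (dom_inner_dom Iq)
      (dom_inner_gt0 Iq) fq.
    by move=> fq0; apply/ae_mu_on; apply: filterS fq0 => t ft _ q' [<-].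
  apply: filterS2 ae_dom_inner (ae_foralln Q) => t It Qt.
  by split => // q; apply: (Qt (pickle q)); exact: pickleK.
pose E t := [/\ P t, f t <> 0 & forall q : rat, dom_inner (ratr q) ->
  before q t -> averaging_abs T I f (ratr q) = 0%E].
have E1 t t' : E t -> E t' -> ~ t < t'.
  move=> [[It Pt] ft Et] [[It' Pt'] ft' Et'].
  move=> /rat_in_itvoo[q]; rewrite in_itv/= => /andP[tq qt'].
  have Iq : dom_inner (ratr q) by apply: dom_inner_between It It' _; rewrite !ltW.
  move: Pt Pt' Et Et' (Pt q Iq) (Pt' q Iq) (Et q Iq) (Et' q Iq).
  rewrite /before; case: T => _ _ _ _ P1 P2 E1 E2.
    apply: ft; apply: P1; first by apply: E2; exact: ltW.
    by rewrite /= in_itv/= (ltW (dom_inner_gt0 It)) ltW.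
  apply: ft'; apply: P2; first by apply: E1; exact: ltW.
  by split; [exact: dom_inner_dom|rewrite /= in_itv/= andbT ltW].
have aeE : \forall t \ae mu, ~ E t.
  have [[t0 Et0]|nE] := pselect (exists t, E t); last first.
    by apply: aeW => t Et; apply: nE; exists t.
  apply: filterS (ae_mu_neq I t0) => t tt0 Et; move: tt0.
  by rewrite neq_lt => /orP[/(E1 _ _ Et Et0)|/(E1 _ _ Et0 Et)].
apply: filterS2 aeP aeE => t Pt nEt ft.
have [q [Iq qt fq]] : exists q : rat, [/\ dom_inner (ratr q), before q t &
    (0 < averaging_abs T I f (ratr q))%E].
  apply: contrapT => nq; apply: nEt; split => // q Iq qt.
  apply/eqP; rewrite eq_le averaging_abs_ge0 ?andbT; last exact: dom_inner_dom.
  by rewrite leNgt; apply/negP => fq; apply: nq; exists q.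
have XV := profile_mem Yf Iq fq.
move: qt XV; rewrite /before /good_itv /near_end; case: T => qt XV.
  have [y Iy /rat_in_itvoo[r]] := dom_inner_above Pt.1.
  rewrite in_itv/= => /andP[tr ry]; exists (q, r); split => /=; last first.
    by rewrite qt ltW.
  split => //; last exact: le_lt_trans tr.
  by apply: dom_inner_between Pt.1 Iy _; rewrite !ltW.
have [y Iy /rat_in_itvoo[r]] := dom_inner_below Pt.1.
rewrite in_itv/= => /andP[yr rt]; exists (r, q); split => /=; last first.
  by rewrite qt ltW.
split => //; last exact: lt_le_trans qt.
by apply: dom_inner_between Iy Pt.1 _; rewrite !ltW.
Qed.

Lemma good_exists : ns_carrier Y <> [set 0] -> exists a b, good_itv a b.
Proof.
move=> Y0; have [f [Yf f0]] : exists f, ns_carrier Y f /\ f <> 0.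
  apply: contrapT => nf; apply: Y0; apply/seteqP; split => [f Yf|_ ->].
    by apply: contrapT => f0; apply: nf; exists f.
  exact: ns_zero.
apply: contrapT => ngood; apply: f0; apply: L0_eqP.
apply: filterS2 (ae_support_good Yf) (L0_0E mu) => t ft ->.
apply: contrapT => ft0; have [p [gp _]] := ft ft0; apply: ngood.
by exists (ratr p.1), (ratr p.2).
Qed.

End GoodIntervals.

(** * Indicators as a vector measure without almost densities *)

Lemma ae_and (R : realType) I (P Q : R -> Prop) :
  (\forall x \ae mu_on R I, P x) -> (\forall x \ae mu_on R I, Q x) ->
  \forall x \ae mu_on R I, P x /\ Q x.
Proof. by move=> aeP aeQ; apply: filterS2 aeP aeQ. Qed.

Section IndicatorMeasure.
Context (R : realType) (I : domain) (T : averaging_op).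
Context (X : banachFunctionSpace R I) (X_oc : order_continuous X).
Local Notation mu := (mu_on R I).
Local Notation leb := (@lebesgue_measure R).
Local Notation Y := (TX T X).
Implicit Types (y z : Y) (h : R -> R) (A B : set (measurableTypeR R)).

Definition TX_fun y : R -> R := L0_fun (ns_val y).

Lemma measurable_TX_fun y : measurable_fun [set: R] (TX_fun y).
Proof. exact: measurable_L0. Qed.

Lemma TX_fun_inj y z : (\forall x \ae mu, TX_fun y x = TX_fun z x) -> y = z.
Proof. by move=> yz; apply: val_inj; exact: L0_eqP. Qed.

Lemma TX_fun0 : \forall x \ae mu, TX_fun 0 x = 0.
Proof. exact: L0_0E. Qed.

Lemma TX_funD y z : \forall x \ae mu, TX_fun (y + z) x = TX_fun y x + TX_fun z x.
Proof. exact: L0_DE. Qed.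

Lemma TX_funZ (c : R) y : \forall x \ae mu, TX_fun (c *: y) x = c * TX_fun y x.
Proof. exact: L0_ZE. Qed.

Lemma TX_funB y z : \forall x \ae mu, TX_fun (y - z) x = TX_fun y x - TX_fun z x.
Proof.
rewrite -scaleN1r; apply: filterS2 (TX_funD y (-1 *: z)) (TX_funZ (-1) z) => x -> ->.
by rewrite mulN1r.
Qed.

Lemma TX_fun_norm_le y z : (\forall x \ae mu, `|TX_fun y x| <= `|TX_fun z x|) -> `|y| <= `|z|.
Proof. by move=> yz; exact: (TX_ideal (ns_val_carrier z) yz).2. Qed.

Lemma TX_fun_exists h z : measurable_fun [set: R] h ->
  (\forall x \ae mu, `|h x| <= `|TX_fun z x|) ->
  exists y, \forall x \ae mu, TX_fun y x = h x.
Proof.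
move=> mh hz; have hE := L0_classE I mh.
have [|Yh _] := @TX_ideal _ _ T X (L0_class I h) (ns_val z) (ns_val_carrier z).
  by apply: filterS2 hE hz => x ->.
by exists (NsElt (mem_set Yh)).
Qed.

Lemma TX_fun_dominated_cvg (y_ : nat -> Y) y z :
  (forall n, \forall x \ae mu, `|TX_fun (y_ n) x| <= `|TX_fun z x|) ->
  (\forall x \ae mu, `|TX_fun y x| <= `|TX_fun z x|) ->
  (\forall x \ae mu, TX_fun (y_ n) x @[n --> \oo] --> TX_fun y x) ->
  y_ @ \oo --> y.
Proof.
move=> y_z yz y_y; apply/cvgrPdist_le => e e0.
have TX_funB_ : \forall x \ae mu, forall n, TX_fun (y - y_ n) x = TX_fun y x - TX_fun (y_ n) x.
  by apply/ae_foralln => n; exact: TX_funB.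
have h n : \forall x \ae mu, `|TX_fun (y - y_ n) x| <= `|TX_fun (2 *: z) x|.
  apply: filterS3 (filterI (y_z n) yz) (TX_funB y (y_ n)) (TX_funZ 2 z) => x [yn y0] -> ->.
  rewrite normrM ger0_norm// mulr2n mulrDl mul1r (le_trans (ler_normB _ _))//.
  exact: lerD.
have h0 : \forall x \ae mu, TX_fun (y - y_ n) x @[n --> \oo] --> (0 : R).
  apply: filterS2 TX_funB_ y_y => x xB xy; rewrite -(subrr (TX_fun y x)).
  under eq_fun do rewrite xB.
  by apply: cvgB => //; exact: cvg_cst.
have := TX_order_continuous X_oc (ns_val_carrier (2 *: z)) h h0.
move=> /cvgrPdist_le/(_ e e0); apply: filterS => n.
by rewrite sub0r normrN => /(le_trans (ler_norm _)).
Qed.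

Variables (a b : R) (gab : good_itv T X a b).
Let J : set (measurableTypeR R) := [set` `[a, b]].

Lemma measurable_good_itv : measurable J.
Proof. exact: measurable_itv. Qed.

Lemma good_itv_finite : (leb J < +oo)%E.
Proof. by rewrite lebesgue_measure_itv; case: ifP => //= _; rewrite -EFinB ltry. Qed.

Definition good_measure : {finite_measure set (measurableTypeR R) -> \bar R} :=
  mfrestr measurable_good_itv good_itv_finite.

(** Locked because comparing two of its values by unfolding is expensive. *)
Definition indic_measure : set (measurableTypeR R) -> Y :=
  locked (fun B => insubd (0 : Y) (L0_class I \1_(B `&` J))).

Let measurableJ B : measurable B -> measurable (B `&` J).
Proof. by move=> mB; apply: measurableI => //; exact: measurable_good_itv. Qed.

Let m1 B : measurable B -> measurable_fun [set: R] (\1_(B `&` J) : R -> R).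
Proof. by move=> mB; have := measurableJ mB; exact: measurable_indic. Qed.

Lemma indic_measureE B : measurable B ->
  \forall x \ae mu, TX_fun (indic_measure B) x = \1_(B `&` J) x.
Proof.
move=> mB; have [K HK] := good_indic_le gab.
have mBJ := measurableJ mB.
have [YB _] := HK _ mBJ (@subIsetr _ _ _).
rewrite /TX_fun /indic_measure -lock val_insubd mem_set//.
exact: L0_classE (m1 mB).
Qed.

Lemma indic_measure_norm B : measurable B ->
  `|indic_measure B| = ns_norm Y (L0_class I \1_(B `&` J)).
Proof.
move=> mB; have [K HK] := good_indic_le gab.
have mBJ := measurableJ mB.
have [YB _] := HK _ mBJ (@subIsetr _ _ _).
rewrite -[LHS]/(ns_norm Y (ns_val (indic_measure B))).
by rewrite /indic_measure -lock val_insubd mem_set.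
Qed.

Lemma indic_measure_lipschitz :
  exists K : R, lipschitz_set_function good_measure indic_measure K.
Proof.
have [K HK] := good_indic_le gab; exists K => B mB.
have mBJ := measurableJ mB.
by rewrite indic_measure_norm//; have [] := HK _ mBJ (@subIsetr _ _ _).
Qed.

Lemma indic_measure_coercive : exists2 k : R, 0 < k & forall B, measurable B ->
  k * fine (good_measure B) <= `|indic_measure B|.
Proof.
have [k k0 Hk] := good_indic_ge gab; exists k => // B mB.
by rewrite indic_measure_norm//; apply: Hk; [exact: measurableJ|exact: subIsetr].
Qed.

Lemma indic_measureU A B : measurable A -> measurable B -> A `&` B = set0 ->
  indic_measure (A `|` B) = indic_measure A + indic_measure B.
Proof.
move=> mA mB AB; apply: TX_fun_inj.
have mAB : measurable (A `|` B) by exact: measurableU.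
have EU := indic_measureE mAB.
have ED := TX_funD (indic_measure A) (indic_measure B).
have EA := indic_measureE mA.
have EB := indic_measureE mB.
apply: filterS2 (ae_and EU ED) (ae_and EA EB) => x [-> ->] [-> ->].
rewrite setIUl !indicE in_setU; have [/set_mem[Ax Jx]|_] := boolP (_ \in A `&` J).
  rewrite memNset ?addr0// => -[Bx _].
  by suff : (A `&` B) x by rewrite AB.
by rewrite add0r.
Qed.

Lemma indic_measure_cvg (A_ : nat -> set (measurableTypeR R)) :
  (forall n, measurable (A_ n)) -> (forall m n, (m <= n)%N -> A_ m `<=` A_ n) ->
  (fun n => indic_measure (A_ n)) @ \oo --> indic_measure (\bigcup_n A_ n).
Proof.
move=> mA_ A_nd; have mA : measurable (\bigcup_n A_ n) by exact: bigcupT_measurable.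
have indic_le B x : `|\1_(B `&` J) x| <= `|\1_([set: R] `&` J) x| :> R.
  rewrite !indicE setTI; have [/set_mem[_ Jx]|_] := boolP (x \in B `&` J).
    by rewrite mem_set.
  by rewrite normr0.
apply: (@TX_fun_dominated_cvg _ _ (indic_measure setT)).
- move=> n; apply: filterS2 (indic_measureE (mA_ n)) (indic_measureE measurableT).
  by move=> x -> ->; exact: indic_le.
- apply: filterS2 (indic_measureE mA) (indic_measureE measurableT).
  by move=> x -> ->; exact: indic_le.
have aeA : \forall x \ae mu, forall n,
    TX_fun (indic_measure (A_ n)) x = \1_(A_ n `&` J) x.
  by apply/ae_foralln => n; exact: indic_measureE.
apply: filterS2 aeA (indic_measureE mA) => x xA ->.
under eq_fun do rewrite xA.
have [[N _ ANx]|nA] := pselect ((\bigcup_n A_ n) x).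
  apply: cvg_near_cst; exists N => // n /= Nn.
  rewrite !indicE; congr (_%:R); congr nat_of_bool; apply/idP/idP => /set_mem[Ax Jx].
    by apply/mem_set; split => //; exists n.
  by apply/mem_set; split => //; exact: A_nd _ _ Nn _ ANx.
apply: cvg_near_cst; apply: nearW => n; rewrite !indicE !memNset//.
  by move=> [].
by move=> [Ax _]; apply: nA; exists n.
Qed.

Lemma indic_measure_sigma_additive : vector_measure indic_measure.
Proof.
move=> F mF tF.
have mU n : measurable (\big[setU/set0]_(i < n) F i).
  by apply: bigsetU_measurable.
have -> : series (indic_measure \o F) =
    (fun n => indic_measure (\big[setU/set0]_(i < n) F i)).
  apply/funext; elim => [|n IH].
    rewrite /series/= big_geq// big_ord0; apply/esym/TX_fun_inj.
    apply: filterS2 (indic_measureE measurable0) TX_fun0 => x -> ->.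
    by rewrite set0I indic0.
  rewrite seriesSr IH big_ord_recr/= indic_measureU//.
    exact: mU.
  by apply: (@trivIset_bigsetUI _ predT) => //; rewrite /predT/= trueE.
have -> : \bigcup_n F n = \bigcup_n \big[setU/set0]_(i < n) F i.
  apply/seteqP; split=> [x [n _ Fx]|x [n _]].
    by exists n.+1 => //; rewrite -bigcup_mkord; exists n => /=.
  by rewrite -bigcup_mkord => -[i _ Fx]; exists i.
apply: indic_measure_cvg => // m n mn; exact: subset_bigsetU.
Qed.

(** A is cut into pieces of measure at most d = |A|/2, one of which, B, is not
    null.  An almost density (A, y) bounds |A| G(B) - |B| G(A) by 2 eps |A| |B|,
    whereas this function is at least d on B. *)
Lemma indic_measure_no_almost_density : exists2 eps : R, 0 < eps &
  forall A y, ~ almost_density good_measure indic_measure eps A y.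
Proof.
have [k k0 Hk] := indic_measure_coercive.
exists (k / 8) => [|A y [mA A0 Ay]]; first by rewrite divr_gt0.
pose m S := fine (good_measure S).
have m0 S : 0 <= m S by exact: fine_ge0.
have a0 : 0 < m A by rewrite /m mu_fine_gt0.
pose d := m A / 2.
have d0 : 0 < d by rewrite divr_gt0.
pose B n : set (measurableTypeR R) := A `&` [set` `[n%:R * d, n.+1%:R * d]].
have mB n : measurable (B n).
  by apply: measurableI => //; exact: measurable_itv.
have [n Bn0] : exists n, 0 < m (B n).
  apply: contrapT => nB; move: A0; rewrite ltNge => /negP; apply.
  have Bneg n : leb.-negligible (B n `&` J).
    apply/negligibleP; first exact: measurableJ.
    apply/eqP; rewrite eq_le measure_ge0 andbT leNgt; apply/negP => Bn.
    by apply: nB; exists n; rewrite /m mu_fine_gt0.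
  have := negligible_bigcup Bneg.
  suff AB : A `&` J `<=` \bigcup_n (B n `&` J).
    move=> /(negligibleS AB)/measure_negligible AJ0.
    by rewrite -[leLHS]/(leb (A `&` J)) AJ0//; exact: measurableJ.
  move=> x [Ax Jx]; have x0 : 0 <= x / d.
    have [Ia _ _ _] := gab; rewrite divr_ge0 ?(ltW d0)//.
    apply: le_trans (ltW (dom_inner_gt0 Ia)) _.
    by move: Jx; rewrite /J /= in_itv/= => /andP[].
  have /andP[nx xn] := truncn_itv x0.
  exists (Num.truncn (x / d)) => //; split => //; split => //=.
  by rewrite in_itv/= -ler_pdivlMr// nx -ler_pdivrMr// ltW.
have BA : B n `<=` A by move=> x [].
have mBd : m (B n) <= d.
  rewrite -lee_fin /m mu_fineK//.
  apply: (@le_trans _ _ (leb [set` `[n%:R * d, n.+1%:R * d]])).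
    apply: le_measure; rewrite ?inE//; first exact: measurableJ.
    by move=> x [[]].
  rewrite lebesgue_measure_itv/=; case: ifP => _; last by rewrite lee_fin ltW.
  by rewrite -EFinB lee_fin -mulrBl -natrB// subSnn mul1r.
pose w := m A *: indic_measure (B n) - m (B n) *: indic_measure A.
have w_le : `|w| <= k / 4 * (m A * m (B n)).
  have -> : w = m A *: (indic_measure (B n) - m (B n) *: y) -
      m (B n) *: (indic_measure A - m A *: y).
    by rewrite !scalerBr !scalerA opprB addrA [m A * _]mulrC subrK.
  apply: (le_trans (ler_normB _ _)); rewrite !normrZ !ger0_norm//.
  have := Ay _ (mB n) BA; have := Ay _ mA (@subset_refl _ _).
  rewrite -/(m A) -/(m (B n)) => h1 h2.
  apply: le_trans (lerD (ler_wpM2l (m0 A) h2) (ler_wpM2l (m0 (B n)) h1)) _.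
  by rewrite le_eqVlt; apply/orP; left; apply/eqP; field.
have w_ge : `|d *: indic_measure (B n)| <= `|w|.
  apply: TX_fun_norm_le.
  have E1 := TX_funZ d (indic_measure (B n)).
  have E2 := TX_funB (m A *: indic_measure (B n)) (m (B n) *: indic_measure A).
  have E3 := TX_funZ (m A) (indic_measure (B n)).
  have E4 := TX_funZ (m (B n)) (indic_measure A).
  have E5 := indic_measureE (mB n).
  have E6 := indic_measureE mA.
  apply: filterS3 (ae_and E1 E2) (ae_and E3 E4) (ae_and E5 E6).
  move=> x [-> ->] [-> ->] [-> ->]; rewrite !indicE.
  have [/set_mem[Bx Jx]|_] := boolP (x \in B n `&` J).
    rewrite mem_set; last by split => //; exact: BA.
    rewrite !mulr1 (ger0_norm (ltW d0)) (le_trans _ (ler_norm _))//.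
    by rewrite lerBrDr (le_trans (lerD (lexx d) mBd))// -splitr.
  by rewrite mulr0 normr0.
have := le_trans w_ge w_le; rewrite normrZ gtr0_norm// => dB.
have := ler_wpM2l (ltW d0) (Hk _ (mB n)); rewrite -/(m (B n)) => dk.
have kAB : 0 < k * (m A * m (B n)) by rewrite !mulr_gt0.
have := le_trans dk dB.
have -> : d * (k * m (B n)) = k * (m A * m (B n)) * 2^-1 by rewrite /d; field.
have -> : k / 4 * (m A * m (B n)) = k * (m A * m (B n)) * 4^-1 by field.
by rewrite ler_pM2l// lef_pV2 ?posrE// ler_nat.
Qed.

End IndicatorMeasure.

(** * Separability of TX *)

Section RationalSpan.
Context (R : realType) (V : normedModType R) (C : countType) (atom : C -> V).
Implicit Types (y z : V).

Definition rat_comb (s : seq (rat * C)) : V :=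
  \sum_(c <- s) ratr c.1 *: atom c.2.

Definition rat_closure : set V :=
  [set y | forall eps : R, 0 < eps -> exists s, `|y - rat_comb s| < eps].

Lemma rat_closure_lim y :
  (forall eps : R, 0 < eps -> exists2 z, rat_closure z & `|y - z| < eps) ->
  rat_closure y.
Proof.
move=> yz eps eps0; have e20 : 0 < eps / 2 by rewrite divr_gt0.
have [z /(_ _ e20)[s zs] yz2] := yz _ e20; exists s.
by rewrite (splitr eps) (le_lt_trans (ler_distD z _ _))// ltrD.
Qed.

Lemma rat_closure_comb s : rat_closure (rat_comb s).
Proof. by move=> eps eps0; exists s; rewrite subrr normr0. Qed.

Lemma rat_closure_atom c : rat_closure (atom c).
Proof.
have := @rat_closure_comb [:: (1, c)].
by rewrite /rat_comb big_seq1/= rmorph1 scale1r.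
Qed.

Lemma rat_closure0 : rat_closure 0.
Proof. by have := @rat_closure_comb [::]; rewrite /rat_comb big_nil. Qed.

Lemma rat_closureD y z : rat_closure y -> rat_closure z -> rat_closure (y + z).
Proof.
move=> My Mz eps eps0; have e20 : 0 < eps / 2 by rewrite divr_gt0.
have [s ys] := My _ e20; have [s' zs] := Mz _ e20; exists (s ++ s').
have -> : rat_comb (s ++ s') = rat_comb s + rat_comb s' by exact: big_cat.
rewrite opprD addrACA.
by rewrite (splitr eps) (le_lt_trans (ler_normD _ _))// ltrD.
Qed.

Lemma rat_closureZ (c : R) y : rat_closure y -> rat_closure (c *: y).
Proof.
move=> My; apply: rat_closure_lim => eps eps0.
have y10 : 0 < `|y| + 1 by rewrite ltr_wpDl.
have : c < c + eps / (`|y| + 1) by rewrite ltrDl divr_gt0.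
move=> /rat_in_itvoo[q]; rewrite in_itv/= => /andP[cq qc].
exists (ratr q *: y); last first.
  rewrite -scalerBl normrZ distrC ger0_norm; last by rewrite subr_ge0 ltW.
  apply: (@le_lt_trans _ _ ((ratr q - c) * (`|y| + 1))).
    by rewrite ler_wpM2l ?lerDl// subr_ge0 ltW.
  by rewrite -ltr_pdivlMr// ltrBlDl.
move=> e e0; have q10 : 0 < `|ratr q : R| + 1 by rewrite ltr_wpDl.
have [s ys] := My _ (divr_gt0 e0 q10).
exists [seq (q * d.1, d.2) | d <- s].
have -> : rat_comb [seq (q * d.1, d.2) | d <- s] = ratr q *: rat_comb s.
  rewrite /rat_comb big_map scaler_sumr; apply: eq_bigr => d _ /=.
  by rewrite rmorphM scalerA.
rewrite -scalerBr normrZ.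
apply: (@le_lt_trans _ _ ((`|ratr q| + 1) * `|y - rat_comb s|)).
  by rewrite ler_wpM2r ?lerDl.
by rewrite mulrC -ltr_pdivlMr.
Qed.

Lemma rat_closureB y z : rat_closure y -> rat_closure z -> rat_closure (y - z).
Proof.
by move=> My Mz; apply: rat_closureD => //; rewrite -scaleN1r; exact: rat_closureZ.
Qed.

Lemma rat_closure_cvg (y_ : nat -> V) y : (forall n, rat_closure (y_ n)) ->
  y_ @ \oo --> y -> rat_closure y.
Proof.
move=> My_ y_y; apply: rat_closure_lim => eps eps0.
have /cvgrPdist_lt/(_ eps eps0)[n _ yn] := y_y.
by exists (y_ n) => //; exact: yn (leqnn n).
Qed.

Lemma rat_closure_sum (J : Type) (r : seq J) (F : J -> V) :
  (forall i, rat_closure (F i)) -> rat_closure (\sum_(i <- r) F i).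
Proof.
move=> MF; elim/big_ind: _ => //; first exact: rat_closure0.
exact: rat_closureD.
Qed.

Lemma rat_closure_dense_sequence : (forall y, rat_closure y) ->
  exists D : nat -> V, dense_sequence D.
Proof.
move=> My; exists (fun n => if unpickle n is Some s then rat_comb s else 0).
move=> y eps eps0; have [s ys] := My y _ eps0.
by exists (pickle s); rewrite pickleK.
Qed.

End RationalSpan.

Section Separability.
Context (R : realType) (I : domain) (T : averaging_op).
Context (X : banachFunctionSpace R I) (X_oc : order_continuous X).
Local Notation mu := (mu_on R I).
Local Notation leb := (@lebesgue_measure R).
Local Notation Y := (TX T X).
Implicit Types (y z : Y) (h : R -> R) (B : set (measurableTypeR R)).

(** The triple (a, b, q) stands for the indicator of the part of [a, b] to the
    right of q. *)
Definition step_atom (p : rat * rat * rat) : Y :=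
  indic_measure T X (ratr p.1.1) (ratr p.1.2) [set` `]ratr p.2, +oo[].

Section GoodInterval.
Variables (a b : rat) (gab : good_itv T X (ratr a) (ratr b)).
Local Notation G := (indic_measure T X (ratr a) (ratr b)).

Let mray (x : R) : measurable ([set` `]x, +oo[] : set (measurableTypeR R)).
Proof. exact: measurable_itv. Qed.

Lemma rat_closure_ray (x : R) : rat_closure step_atom (G [set` `]x, +oo[]).
Proof.
have [K HK] := indic_measure_lipschitz gab.
apply: rat_closure_lim => eps eps0.
have K10 : 0 < `|K| + 1 by rewrite ltr_wpDl.
have : x < x + eps / (`|K| + 1) by rewrite ltrDl divr_gt0.
move=> /rat_in_itvoo[q]; rewrite in_itv/= => /andP[xq qx].
exists (G [set` `]ratr q, +oo[]).
  exact: (@rat_closure_atom _ _ _ step_atom (a, b, q)).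
have mxq : measurable ([set` `]x, ratr q]] : set (measurableTypeR R)).
  exact: measurable_itv.
have -> : [set` `]x, +oo[] = [set` `]x, ratr q]] `|` [set` `]ratr q, +oo[] :> set R.
  apply/seteqP; split => t /=; rewrite !in_itv/= ?andbT.
    by move=> ->; have [|] := leP t (ratr q); [left|right].
  by case=> [/andP[]//|]; exact: lt_trans.
rewrite indic_measureU//; last first.
  apply/seteqP; split => // t [] /=; rewrite !in_itv/= andbT => /andP[_ tq].
  by rewrite ltNge tq.
rewrite addrK; apply: le_lt_trans (HK _ mxq) _.
have qx0 : 0 <= ratr q - x by rewrite subr_ge0 ltW.
apply: (@le_lt_trans _ _ ((`|K| + 1) * (ratr q - x))); last first.
  by rewrite mulrC -ltr_pdivlMr// ltrBlDl.
apply: (@le_trans _ _ (`|K| * (ratr q - x))); last first.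
  by rewrite ler_wpM2r// lerDl.
apply: (@le_trans _ _ (`|K| * fine (good_measure (ratr a) (ratr b) [set` `]x, ratr q]]))).
  by rewrite ler_wpM2r ?fine_ge0// ler_norm.
rewrite ler_wpM2l// -lee_fin mu_fineK//.
apply: (@le_trans _ _ (leb [set` `]x, ratr q]])).
  apply: le_measure; rewrite ?inE//.
    by apply: measurableI => //; exact: measurable_good_itv.
by rewrite lebesgue_measure_itv/= lte_fin xq -EFinB.
Qed.

(** The pi-lambda theorem, applied to the sets whose indicator is in the
    closure; the lambda-system properties come from sigma-additivity of G. *)
Lemma rat_closure_indic B : measurable B -> rat_closure step_atom (G B).
Proof.
have GE : @measurable _ (measurableTypeR R) = <<s @RGenOInfty.G R >>.
  exact: RGenOInfty.measurableE.
move=> mB; have : <<s @RGenOInfty.G R >> B by rewrite -GE.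
have GT : rat_closure step_atom (G setT).
  have := rat_closure_ray (ratr a - 1); congr (rat_closure _ _).
  have m1 := mray (ratr a - 1).
  apply: TX_fun_inj; apply: filterS2 (indic_measureE gab m1)
    (indic_measureE gab measurableT) => x -> ->.
  congr (\1_ _ x); rewrite setTI; apply/setIidr => t /=.
  by rewrite !in_itv/= andbT => /andP[at_ _]; rewrite ltrBlDr ltr_pwDr.
apply: (@dynkin_induction _ (measurableTypeR R) (@RGenOInfty.G R)
  (fun B => rat_closure step_atom (G B)) GE _ GT).
- move=> _ _ [x ->] [y ->]; exists (Num.max x y).
  by apply/seteqP; split => t /=; rewrite !in_itv/= !andbT gt_max => /andP.
- by move=> _ [x ->]; exact: rat_closure_ray.
- move=> S mS MS; have mCS := measurableC mS.
  have -> : G (~` S) = G setT - G S; last exact: rat_closureB.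
  rewrite -(setUCr S) indic_measureU ?setICr//.
  by rewrite addrAC subrr add0r.
- move=> F mF tF MF.
  apply: (rat_closure_cvg _ (indic_measure_sigma_additive X_oc gab mF tF)) => n.
  by rewrite /series/=; apply: rat_closure_sum.
Qed.

End GoodInterval.
End Separability.

Section Density.
Import HBNNSimple.
Context (R : realType) (I : domain) (T : averaging_op).
Context (X : banachFunctionSpace R I) (X_oc : order_continuous X).
Local Notation mu := (mu_on R I).
Local Notation Y := (TX T X).
Implicit Types (y z w : Y) (h : R -> R) (B : set (measurableTypeR R)).

(** The closed rational span, as a property of functions instead of classes, so
    that pointwise computations apply to it. *)
Definition approximable h := exists2 z : Y,
  rat_closure (@step_atom R I T X) z & \forall x \ae mu, TX_fun z x = h x.

Lemma approximable_ext h h' : approximable h -> (\forall x \ae mu, h x = h' x) ->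
  approximable h'.
Proof.
by move=> [z Mz zh] hh'; exists z => //; apply: filterS2 zh hh' => x ->.
Qed.

Lemma approximableD h h' : approximable h -> approximable h' ->
  approximable (fun x => h x + h' x).
Proof.
move=> [z Mz zh] [z' Mz' zh']; exists (z + z'); first exact: rat_closureD.
by apply: filterS3 (TX_funD z z') zh zh' => x -> -> ->.
Qed.

Lemma approximableZ c h : approximable h -> approximable (fun x => c * h x).
Proof.
move=> [z Mz zh]; exists (c *: z); first exact: rat_closureZ.
by apply: filterS2 (TX_funZ c z) zh => x -> ->.
Qed.

Lemma approximable0 : approximable (fun=> 0).
Proof. by exists 0; [exact: rat_closure0|exact: TX_fun0]. Qed.

Lemma approximable_lim (h_ : nat -> R -> R) h w :
  (forall n, approximable (h_ n)) -> measurable_fun [set: R] h ->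
  (forall n, \forall x \ae mu, `|h_ n x| <= `|TX_fun w x|) ->
  (\forall x \ae mu, h_ n x @[n --> \oo] --> h x) -> approximable h.
Proof.
move=> Mh mh hw hh.
have hw' : \forall x \ae mu, `|h x| <= `|TX_fun w x|.
  apply: filterS2 (ae_foralln hw) hh => x hwx hhx.
  by apply: (ler_cvg_to (cvg_norm hhx) (@cvg_cst _ `|TX_fun w x| _ _ _)); exact: nearW.
have [y yh] := TX_fun_exists mh hw'.
have ex n : exists z, rat_closure (@step_atom R I T X) z /\
  \forall x \ae mu, TX_fun z x = h_ n x by have [z] := Mh n; exists z.
have [y_ y_h] := choice ex.
have My n := (y_h n).1.
have y_hE n := (y_h n).2.
exists y => //; apply: (rat_closure_cvg My).
apply: (@TX_fun_dominated_cvg _ _ _ _ X_oc y_ y w).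
- by move=> n; apply: filterS2 (y_hE n) (hw n) => x ->.
- by apply: filterS2 yh hw' => x ->.
- apply: filterS3 (ae_foralln y_hE) yh hh => x xh -> hx.
  by under eq_fun do rewrite xh.
Qed.

Section OnGoodInterval.
Variables (a b : rat) (gab : good_itv T X (ratr a) (ratr b)).
Let J : set (measurableTypeR R) := [set` `[ratr a, ratr b]].

Lemma approximable_indic B : measurable B -> approximable \1_(B `&` J).
Proof.
move=> mB; exists (indic_measure T X (ratr a) (ratr b) B).
  exact: rat_closure_indic.
exact: indic_measureE.
Qed.

Lemma approximable_simple (s : seq R) (A : R -> set (measurableTypeR R)) :
  (forall r, measurable (A r)) ->
  approximable (fun x => \sum_(r <- s) r * \1_(A r `&` J) x).
Proof.
move=> mA; elim: s => [|r s IH].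
  apply: approximable_ext approximable0 _; apply: aeW => x.
  by rewrite big_nil.
apply: approximable_ext
  (approximableD (approximableZ r (approximable_indic (mA r))) IH) _.
by apply: aeW => x; rewrite big_cons.
Qed.

Lemma approximable_nonneg h w : measurable_fun [set: R] h ->
  (forall x, 0 <= h x) -> (\forall x \ae mu, h x <= `|TX_fun w x|) ->
  approximable (fun x => h x * \1_J x).
Proof.
move=> mh h0 hw.
have mhE : measurable_fun [set: measurableTypeR R] (fun x => (h x)%:E).
  exact/measurable_EFinP.
have mJ : measurable J by exact: measurable_itv.
pose f n : {nnsfun (measurableTypeR R) >-> R} := nnsfun_approx measurableT mhE n.
have hE0 x : [set: measurableTypeR R] x -> (0 <= (h x)%:E)%E by rewrite lee_fin.
have fh n x : f n x <= h x.
  have := le_approx n hE0 (Logic.I : [set: measurableTypeR R] x).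
  by rewrite /f nnsfun_approxE lee_fin.
have J1 x : 0 <= (\1_J x : R) <= 1.
  by rewrite indicE; case: (x \in J); rewrite ?lexx ler01.
apply: (@approximable_lim (fun n x => f n x * \1_J x) _ w).
- move=> n; have ff : finite_set (range (f n)) by [].
  apply: approximable_ext (@approximable_simple
    (finmap.enum_fset (fset_set (range (f n)))) (fun r => f n @^-1` [set r]) _) _.
    by move=> r; exact: measurable_sfunP.
  apply: aeW => x; rewrite [in RHS](fimfunE (f n)) fsbig_finite//= mulr_suml.
  by apply: eq_bigr => r _; rewrite indicI mulrA.
- by apply: measurable_funM => //; exact: measurable_indic.
- move=> n; apply: filterS hw => x hx; have /andP[j0 j1] := J1 x.
  rewrite ger0_norm ?mulr_ge0//.
  by rewrite (le_trans _ hx)// (le_trans _ (fh n x))// ler_piMr.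
- apply: aeW => x; apply: cvgM; last exact: cvg_cst.
  have := cvg_nnsfun_approx measurableT mhE hE0 (Logic.I : [set: measurableTypeR R] x).
  by move=> /fine_cvg.
Qed.

End OnGoodInterval.
(** The good intervals with rational ends, enumerated through a coding of pairs
    of rationals. *)
Definition nth_good_itv (n : nat) : set (measurableTypeR R) :=
  if @unpickle (rat * rat)%type n is Some p then
    [set x | good_itv T X (ratr p.1) (ratr p.2) /\ ratr p.1 <= x <= ratr p.2]
  else set0.

Lemma measurable_nth_good_itv n : measurable (nth_good_itv n).
Proof.
rewrite /nth_good_itv; case: unpickle => [p|]; last exact: measurable0.
have [gp|ngp] := pselect (good_itv T X (ratr p.1) (ratr p.2)).
  rewrite (_ : [set _ | _] = [set` `[ratr p.1, ratr p.2]]).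
    exact: measurable_itv.
  by apply/seteqP; split => x /=; rewrite in_itv/= => // -[].
rewrite (_ : [set _ | _] = set0); first exact: measurable0.
by apply/seteqP; split => // x [].
Qed.

Definition good_union n : set (measurableTypeR R) :=
  \big[setU/set0]_(i < n) nth_good_itv i.

Lemma measurable_good_union n : measurable (good_union n).
Proof. by apply: bigsetU_measurable => i _; exact: measurable_nth_good_itv. Qed.

Lemma approximable_good_union h w n : measurable_fun [set: R] h ->
  (forall x, 0 <= h x) -> (\forall x \ae mu, h x <= `|TX_fun w x|) ->
  approximable (fun x => h x * \1_(good_union n) x).
Proof.
move=> mh h0 hw; elim: n => [|n IH].
  apply: approximable_ext approximable0 _; apply: aeW => x.
  by rewrite /good_union big_ord0 indic0 mulr0.
(* h' is the part of h that the first n good intervals do not cover. *)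
pose h' x := h x * \1_(~` good_union n) x.
have mCU : measurable (~` good_union n).
  by apply: measurableC; exact: measurable_good_union.
have mh' : measurable_fun [set: R] h'.
  by apply: measurable_funM => //; exact: measurable_indic.
have h'0 x : 0 <= h' x by rewrite mulr_ge0.
have h'w : \forall x \ae mu, h' x <= `|TX_fun w x|.
  by apply: filterS hw => x; apply: le_trans; rewrite ler_piMr// indicE.
have step : approximable (fun x => h' x * \1_(nth_good_itv n) x).
  rewrite /nth_good_itv; case: unpickle => [p|]; last first.
    apply: approximable_ext approximable0 _; apply: aeW => x.
    by rewrite indic0 mulr0.
  have [gp|ngp] := pselect (good_itv T X (ratr p.1) (ratr p.2)); last first.
    apply: approximable_ext approximable0 _; apply: aeW => x.
    by rewrite indicE memNset ?mulr0// => -[].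
  apply: approximable_ext (approximable_nonneg gp mh' h'0 h'w) _.
  apply: aeW => x; congr (_ * \1_ _ x); apply/seteqP.
  by split => t /=; rewrite in_itv/= => // -[].
apply: approximable_ext (approximableD IH step) _; apply: aeW => x.
rewrite /h' -mulrA -mulrDr /good_union big_ord_recr/=; congr (_ * _).
rewrite !indicE in_setU in_setC.
by case: (x \in _); case: (x \in _); rewrite ?(mul0r, mul1r, addr0, add0r).
Qed.

Lemma approximable_below h w : measurable_fun [set: R] h ->
  (forall x, 0 <= h x) -> (\forall x \ae mu, h x <= `|TX_fun w x|) -> approximable h.
Proof.
move=> mh h0 hw.
apply: (@approximable_lim (fun n x => h x * \1_(good_union n) x) _ w) => //.
- by move=> n; exact: approximable_good_union hw.
- move=> n; apply: filterS hw => x; apply: le_trans.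
  by rewrite ger0_norm ?mulr_ge0// ler_piMr// indicE.
- have := ae_support_good (ns_val_carrier w).
  move=> sw; apply: filterS2 hw sw => x hwx swx.
  have [hx0|hx0] := eqVneq (h x) 0.
    by rewrite hx0; under eq_fun do rewrite mul0r; exact: cvg_cst.
  have [|p [gp px]] := swx.
    move=> wx0; move: hwx; rewrite /TX_fun wx0 normr0 => hx.
    by move/eqP: hx0; apply; apply/eqP; rewrite eq_le hx h0.
  have [k kp] : exists k, unpickle k = Some p.
    by exists (pickle p); exact: pickleK.
  apply: cvg_near_cst; exists k.+1 => // n kn.
  rewrite indicE mem_set ?mulr1// /good_union -bigcup_mkord.
  by exists k => //; rewrite /nth_good_itv kp.
Qed.

Theorem TX_separable : exists D : nat -> Y, dense_sequence D.
Proof.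
apply: (@rat_closure_dense_sequence _ _ _ (@step_atom R I T X)) => y.
suff [z Mz zy] : approximable (TX_fun y) by rewrite -(TX_fun_inj zy).
pose hp x := Num.max (TX_fun y x) 0; pose hm x := Num.max (- TX_fun y x) 0.
have my := measurable_TX_fun y.
have mp : measurable_fun [set: R] hp.
  by apply: measurable_maxr => //; exact: measurable_cst.
have mm : measurable_fun [set: R] hm.
  by apply: measurable_maxr; [exact: measurableT_comp|exact: measurable_cst].
have Mp : approximable hp.
  apply: (@approximable_below _ y) => // [x|]; first by rewrite le_max lexx orbT.
  by apply: aeW => x; rewrite ge_max ler_norm normr_ge0.
have Mm : approximable hm.
  apply: (@approximable_below _ y) => // [x|]; first by rewrite le_max lexx orbT.
  by apply: aeW => x; rewrite ge_max normr_ge0 -normrN ler_norm.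
apply: approximable_ext (approximableD Mp (approximableZ (-1) Mm)) _.
apply: aeW => x; rewrite /hp /hm mulN1r.
have [y0|y0] := leP 0 (TX_fun y x).
  by rewrite (max_idPr _) ?oppr_le0// subr0.
by rewrite (max_idPl _) ?oppr_ge0 ?(ltW y0)// opprK add0r.
Qed.

End Density.

Theorem corollary6p4 (R : realType) (T : averaging_op) (I : domain)
    (X : banachFunctionSpace R I) (X_oc : order_continuous X)
    (TX_neq0 : ns_carrier (TX T X) <> [set 0]) :
  ~ isomorphic_to_dual (TX T X) /\ ~ radon_nikodym_property (TX T X).
Proof.
have [a [b gab]] := good_exists TX_neq0.
have [K GK] := indic_measure_lipschitz gab.
have G_vm := indic_measure_sigma_additive X_oc gab.
have [eps eps0 no_density] := indic_measure_no_almost_density gab.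
have mu0 : (0 < good_measure a b setT)%E.
  have [_ _ ab _] := gab.
  rewrite -[ltRHS]/(lebesgue_measure (setT `&` [set` `[a, b]])) setTI.
  by rewrite lebesgue_measure_itv/= lte_fin ab lte_fin subr_gt0.
split=> [TX_dual|TX_rnp].
  have [D D_dense] := TX_separable T X_oc.
  have [A [y Ay]] := separable_dual_almost_density G_vm GK D_dense TX_dual eps0 mu0.
  exact: no_density Ay.
have [A [y Ay]] := rnp_almost_density G_vm GK TX_rnp eps0 mu0.
exact: no_density Ay.
Qed.
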